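(* The set $\Sigma$ of all weakly sparse classes of graphs is not sup-dense in the FO-transduction quasi-order $\sqsubseteq_{\rm FO}$.
   Context: Graphs are finite, undirected and loopless; a class of graphs is a set of graphs considered up to isomorphism, and every class contains the empty graph. Only infinite hereditary classes (closed under induced subgraphs) are considered. A class is weakly sparse if there is an integer $s$ such that no graph in the class contains $K_{s,s}$ as a subgraph. For a set $\mathcal U$ of unary relation symbols, a $\mathcal U$-colored graph is a graph with additional unary relations in $\mathcal U$. Formulas are first-order, with adjacency relation $E$. Sup-density. A set $\Upsilon$ of classes is sup-dense in $\sqsubseteq_{\rm FO}$ if, for every two classes $\mathscr C$ and $\mathscr D$, we have $\mathscr C\equiv_{\rm FO}\mathscr D$ if and only if for all $\mathscr F\in\Upsilon$: $(\mathscr F\sqsubseteq_{\rm FO}\mathscr C)\iff(\mathscr F\sqsubseteq_{\rm FO}\mathscr D)$. Transductions. For a positive integer $k$, the $k$-copy operation $\mathsf C_k$ maps a graph $G$ to the graph consisting of $k$ copies of $G$ in which the $k$ copies of each vertex are made pairwise adjacent (no other edges between the copies). The coloring operation $\Gamma_{\mathcal U}$ maps a graph to the set of all its $\mathcal U$-expansions. A simple interpretation $\mathsf I=(\nu(x),\eta(x,y))$ of graphs in $\mathcal U$-colored graphs is a pair of first-order formulas with $\eta$ symmetric and anti-reflexive; $\mathsf I(G^+)$ is the graph with vertex set $\nu(G^+)$ and edge set $\eta(G^+)\cap\nu(G^+)^2$. A transduction is a composition $\mathsf T=\mathsf I\circ\Gamma_{\mathcal U}\circ\mathsf C_k$, so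 $\mathsf T(G)=\{\mathsf I(G^+): G^+\in\Gamma_{\mathcal U}(\mathsf C_k(G))\}$. For a class $\mathscr D$, $\mathsf T(\mathscr D)=\bigcup_{G\in\mathscr D}\mathsf T(G)$ up to isomorphism. $\mathscr C\sqsubseteq_{\rm FO}\mathscr D$ means $\mathscr C\subseteq\mathsf T(\mathscr D)$ for some transduction $\mathsf T$; $\mathscr C\equiv_{\rm FO}\mathscr D$ means $\mathscr C\sqsubseteq_{\rm FO}\mathscr D$ and $\mathscr D\sqsubseteq_{\rm FO}\mathscr C$. *)

(* Defs.v *)
From mathcomp Require Import all_boot.

Set Implicit Arguments.
Unset Strict Implicit.
Unset Printing Implicit Defensive.

(** * Finite simple graphs *)

Record sgraph := SGraph {
  vertex :> finType;
  adj : rel vertex;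
  adj_sym : symmetric adj;
  adj_irr : irreflexive adj }.

Definition graph_iso (G H : sgraph) : Prop :=
  exists2 f : G -> H, bijective f & forall x y, adj (f x) (f y) = adj x y.

(* Not necessarily induced. *)
Definition is_subgraph (H G : sgraph) : Prop :=
  exists2 f : H -> G, injective f & forall x y, adj x y -> adj (f x) (f y).

Section Induced.
Variables (G : sgraph) (S : {set G}).
Definition induced_adj : rel {x | x \in S} := fun x y => adj (val x) (val y).
Lemma induced_adj_sym : symmetric induced_adj.
Proof. by move=> x y; apply: adj_sym. Qed.
Lemma induced_adj_irr : irreflexive induced_adj.
Proof. by move=> x; apply: adj_irr. Qed.
Definition induced : sgraph := SGraph induced_adj_sym induced_adj_irr.
End Induced.

Section Empty.
Definition empty_adj : rel void := fun _ _ => false.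
Lemma empty_adj_sym : symmetric empty_adj. Proof. by []. Qed.
Lemma empty_adj_irr : irreflexive empty_adj. Proof. by []. Qed.
Definition empty_graph : sgraph := SGraph empty_adj_sym empty_adj_irr.
End Empty.

Section CompleteBipartite.
Variables s t : nat.
Definition Kbip_adj : rel ('I_s + 'I_t) := fun x y =>
  match x, y with
  | inl _, inr _ | inr _, inl _ => true
  | _, _ => false
  end.
Lemma Kbip_adj_sym : symmetric Kbip_adj. Proof. by case=> ? []. Qed.
Lemma Kbip_adj_irr : irreflexive Kbip_adj. Proof. by case. Qed.
Definition Kbip : sgraph := SGraph Kbip_adj_sym Kbip_adj_irr.
End CompleteBipartite.

(** * Infinite hereditary classes of graphs, up to isomorphism *)

Record graph_class := GraphClass {
  in_class :> sgraph -> Prop;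
  class_iso : forall G H, graph_iso G H -> in_class G -> in_class H;
  class_empty : in_class empty_graph;
  class_hereditary : forall (G : sgraph) (S : {set G}),
    in_class G -> in_class (induced S);
  (* no finite list of graphs exhausts the isomorphism types of the class *)
  class_infinite : forall n (L : 'I_n -> sgraph),
    exists2 G, in_class G & forall i, ~ graph_iso G (L i) }.

Definition weakly_sparse (C : graph_class) : Prop :=
  exists s : nat, forall G, C G -> ~ is_subgraph (Kbip s s) G.

(** * First-order logic on colored graphs *)

Record colored_graph (U : Type) := ColoredGraph {
  uncolored :> sgraph;
  color : U -> {set uncolored} }.

(* [formula U n]: formulas whose free variables are among ['I_n]. Under a
   quantifier, variable [0] is the bound one and the others are shifted. *)
Inductive formula (U : Type) : nat -> Type :=
| FEq n : 'I_n -> 'I_n -> formula U n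
| FAdj n : 'I_n -> 'I_n -> formula U n
| FColor n : U -> 'I_n -> formula U n
| FNot n : formula U n -> formula U n
| FAnd n : formula U n -> formula U n -> formula U n
| FEx n : formula U n.+1 -> formula U n.

Fixpoint sat U (G : colored_graph U) n (phi : formula U n) :
    n.-tuple G -> bool :=
  match phi in formula _ n return n.-tuple G -> bool with
  | FEq _ i j => fun e => tnth e i == tnth e j
  | FAdj _ i j => fun e => adj (tnth e i) (tnth e j)
  | FColor _ u i => fun e => tnth e i \in color G u
  | FNot _ phi => fun e => ~~ sat phi e
  | FAnd _ phi psi => fun e => sat phi e && sat psi e
  | FEx _ phi => fun e => [exists v : G, sat phi [tuple of v :: e]]
  end.

Definition sat1 U (G : colored_graph U) (nu : formula U 1) (x : G) : bool :=
  sat nu [tuple x].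

Definition sat2 U (G : colored_graph U) (eta : formula U 2) : rel G :=
  fun x y => sat eta [tuple x; y].
Arguments sat2 {U} G eta x y.

(** * Transductions *)

Record simple_interp (U : Type) := SimpleInterp {
  nu : formula U 1;
  eta : formula U 2;
  eta_sym : forall G : colored_graph U, symmetric (sat2 G eta);
  eta_irr : forall G : colored_graph U, irreflexive (sat2 G eta) }.

Section ApplyInterp.
Variables (U : Type) (I : simple_interp U) (G : colored_graph U).
Definition interp_adj : rel {x : G | sat1 (nu I) x} :=
  fun x y => sat2 G (eta I) (val x) (val y).
Lemma interp_adj_sym : symmetric interp_adj.
Proof. by move=> x y; apply: eta_sym. Qed.
Lemma interp_adj_irr : irreflexive interp_adj.
Proof. by move=> x; apply: eta_irr. Qed.
Definition apply_interp : sgraph := SGraph interp_adj_sym interp_adj_irr.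
End ApplyInterp.

Section Copy.
Variables (k : nat) (G : sgraph).
Definition copy_adj : rel ('I_k * G) := fun x y =>
  if x.1 == y.1 then adj x.2 y.2 else x.2 == y.2.
Lemma copy_adj_sym : symmetric copy_adj.
Proof. by move=> x y; rewrite /copy_adj eq_sym adj_sym [x.2 == _]eq_sym. Qed.
Lemma copy_adj_irr : irreflexive copy_adj.
Proof. by move=> x; rewrite /copy_adj eqxx adj_irr. Qed.
Definition copy : sgraph := SGraph copy_adj_sym copy_adj_irr.
End Copy.

Record transduction := Transduction {
  copies : nat;
  copies_gt0 : 0 < copies;
  colors : Type;
  interp : simple_interp colors }.

(* [H] belongs to [T(G)], up to isomorphism. *)
Definition transduces (T : transduction) (G H : sgraph) : Prop :=
  exists c : colors T -> {set copy (copies T) G},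
    graph_iso H (apply_interp (interp T) (ColoredGraph c)).

Definition transduction_image (T : transduction) (D : graph_class)
    (H : sgraph) : Prop :=
  exists2 G, D G & transduces T G H.

Definition fo_le (C D : graph_class) : Prop :=
  exists T : transduction, forall H, C H -> transduction_image T D H.

Definition fo_equiv (C D : graph_class) : Prop := fo_le C D /\ fo_le D C.

Definition sup_dense (Upsilon : graph_class -> Prop) : Prop :=
  forall C D : graph_class,
    fo_equiv C D <-> (forall F, Upsilon F -> (fo_le F C <-> fo_le F D)).

(* Main.v *)
From mathcomp Require Import all_boot zify.
Require Import Defs.

(* Let [C] be the union of the class of threshold graphs (graphs definable in
   coloured linear orders, which transduce all half-graphs) and of a class [D],
   such that the same weakly sparse classes lie below [C] and below [D], while
   [C] is not below [D].

   A weakly sparse class below the threshold graphs consists, for some [n], of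
   graphs [G] without large bicliques interpreted in coloured linear orders by
   types of rank [n]. Such graphs are uniformly quasi-wide. Indeed, Ramsey's
   theorem applied to the types of intervals cuts the order into homogeneous
   blocks; an edge between distant blocks would be repeated into a biclique, and
   for the same reason few vertices outside the blocks have neighbours inside.
   Deleting these few vertices thus puts vertices of distant blocks far apart.

   [D] consists of the induced subgraphs of the [2n]-subdivisions of the graphs
   with parameter [n], for all [n]. A fixed transduction recovers the graphs of
   parameter [n] from their subdivisions, so [D] is above every weakly sparse class
   that is below the threshold graphs. At radius [r], the subdivisions with
   [n > r] are quasi-wide whatever the subdivided graph is, so [D] is uniformly
   quasi-wide. By Gaifman locality, a uniformly quasi-wide class does not
   transduce arbitrarily long half-graphs. *)

Set Implicit Arguments.
Unset Strict Implicit.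
Unset Printing Implicit Defensive.

(** * Locality of first-order logic *)

Section Near.
Variables (V : finType) (R : rel V).

Fixpoint near d (x y : V) : bool :=
  if d is d'.+1 then near d' x y || [exists z, R x z && near d' z y]
  else x == y.

Lemma near_refl d x : near d x x.
Proof. by elim: d => [|d IH] /=; rewrite ?eqxx ?IH. Qed.

Lemma near_leq d e x y : d <= e -> near d x y -> near e x y.
Proof.
move=> /subnK <-; elim: (e - d) => [|k IH] //= H.
by rewrite IH.
Qed.

Lemma near_step d x y z : R x y -> near d y z -> near d.+1 x z.
Proof. by move=> xy yz /=; apply/orP; right; apply/existsP; exists y; rewrite xy. Qed.

Lemma near_trans d e x y z : near d x y -> near e y z -> near (d + e) x z.
Proof.
elim: d x => [|d IH] x /=; first by move/eqP->.
case/orP=> [xy|/existsP[w /andP[xw wy]]] yz; first by rewrite IH.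
by apply/orP; right; apply/existsP; exists w; rewrite xw IH.
Qed.

(** Induction on walks read backwards from their end [x]: an invariant indexed by the length bound
    only has to survive relaxing the bound and prepending one edge. *)
Lemma near_inv (I : nat -> V -> Prop) x :
  I 0 x -> (forall d y, I d y -> I d.+1 y) ->
  (forall d y z, R y z -> I d z -> I d.+1 y) ->
  forall d y, near d y x -> I d y.
Proof.
move=> I0 IS IR; elim=> [|d IH] y /=; first by move/eqP->.
case/orP=> [/IH/IS //|/existsP[z /andP[yz zx]]].
exact: IR yz (IH _ zx).
Qed.

Hypothesis Rsym : symmetric R.

Lemma near_sym d : symmetric (near d).
Proof.
have half x y : near d x y -> near d y x.
  apply: (@near_inv (fun d z => near d y z)); first exact: near_refl.
    by move=> e z; apply: near_leq.
  move=> e z w zw yw; rewrite -addn1; apply: near_trans yw _.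
  by apply: near_step (near_refl 0 _); rewrite Rsym.
by move=> x y; apply/idP/idP; apply: half.
Qed.

End Near.

Lemma near_sub (V : finType) (R R' : rel V) d x y :
  subrel R R' -> near R d x y -> near R' d x y.
Proof.
move=> RR'; elim: d x => [|d IH] x //= /orP[/IH->//|/existsP[z /andP[xz zy]]].
by apply/orP; right; apply/existsP; exists z; rewrite RR' // IH.
Qed.

(** * Local back-and-forth systems and Gaifman locality *)

Section LocalTypes.
Variables (V : finType) (R : rel V) (K : eqType) (col : V -> K).
Implicit Types (p : seq (V * V)) (a b : V * V).

Definition local_atom rho p := forall a b, a \in p -> b \in p ->
  [/\ col a.1 = col a.2, R a.1 b.1 = R a.2 b.2 &
      forall d, d <= rho -> near R d a.1 b.1 = near R d a.2 b.2].

(** An Ehrenfeucht-Fraisse game of [q] rounds on two positions in the same graph, in which each new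
    vertex must lie within [rho] of one already played. It only sees a bounded neighbourhood of the
    position. *)
Fixpoint local_bf rho q p : Prop :=
  local_atom rho p /\
  if q is q'.+1 then forall a, a \in p ->
    (forall v, near R rho a.1 v -> exists v', local_bf rho q' ((v, v') :: p)) /\
    (forall v', near R rho a.2 v' -> exists v, local_bf rho q' ((v, v') :: p))
  else True.

Lemma local_bf_atom rho q p : local_bf rho q p -> local_atom rho p.
Proof. by case: q => [|q] []. Qed.

Lemma local_bf_sub rho q p p' :
  {subset p' <= p} -> local_bf rho q p -> local_bf rho q p'.
Proof.
elim: q p p' => [|q IH] p p' sp [Hat HS]; split=> //.
- by move=> a b /sp ap /sp bp; apply: Hat.
- by move=> a b /sp ap /sp bp; apply: Hat.
have sc w : {subset w :: p' <= w :: p}.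
  by move=> z; rewrite !inE => /orP[->//|/sp->]; rewrite orbT.
move=> a /sp /HS[F B]; split=> v /[dup] nv.
  by move=> /F[v' H]; exists v'; apply: IH H.
by move=> /B[v' H]; exists v'; apply: IH H.
Qed.

Lemma local_bf_rho rho rho' q p :
  rho' <= rho -> local_bf rho q p -> local_bf rho' q p.
Proof.
move=> le; elim: q p => [|q IH] p [Hat HS]; split=> //.
- move=> a b ap bp; case: (Hat _ _ ap bp) => H1 H2 H3; split=> // d ld.
  by apply: H3; apply: leq_trans le.
- move=> a b ap bp; case: (Hat _ _ ap bp) => H1 H2 H3; split=> // d ld.
  by apply: H3; apply: leq_trans le.
move=> a /HS[F B]; split=> v nv.
  by have [v' H] := F _ (near_leq le nv); exists v'; apply: IH.
by have [v' H] := B _ (near_leq le nv); exists v'; apply: IH.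
Qed.

Lemma local_bf_pred rho q p : local_bf rho q.+1 p -> local_bf rho q p.
Proof.
elim: q p => [|q IH] p; first by case.
case=> Hat HS; split=> // a /HS[F B]; split=> v.
  by move=> /F[v' H]; exists v'; apply: IH.
by move=> /B[v' H]; exists v'; apply: IH.
Qed.

Lemma local_bf_leq rho rho' q q' p : rho' <= rho -> q' <= q ->
  local_bf rho q p -> local_bf rho' q' p.
Proof.
move=> le /subnK <- H; apply: local_bf_rho le _.
by elim: (q - q') H => [|k IH] //; rewrite addSn => /local_bf_pred.
Qed.

Lemma local_bf_trans rho q (t : seq (V * V * V)) :
  local_bf rho q [seq x.1 | x <- t] ->
  local_bf rho q [seq (x.1.2, x.2) | x <- t] ->
  local_bf rho q [seq (x.1.1, x.2) | x <- t].
Proof.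
elim: q t => [|q IH] t [A1 S1] [A2 S2]; (split; first
  (move=> _ _ /mapP[a ta ->] /mapP[b tb ->] /=;
   have [H1 H2 H3] := A1 _ _ (map_f _ ta) (map_f _ tb);
   have [/= J1 J2 J3] := A2 _ _ (map_f _ ta) (map_f _ tb);
   split; [by rewrite H1|by rewrite H2|by move=> d ld; rewrite H3 ?J3])) => //.
move=> _ /mapP[a ta ->] /=.
have [F1 B1] := S1 _ (map_f _ ta); have [F2 B2] := S2 _ (map_f _ ta).
split=> [v nv|v nv].
  have [v1 Hv1] := F1 _ nv.
  have [] := F2 v1.
    have [_ _ H] := local_bf_atom Hv1
      (mem_behead (s := (v, v1) :: _) (map_f fst ta)) (mem_head _ _).
    by rewrite -(H rho).
  by move=> v2 Hv2; exists v2; apply: (IH ((v, v1, v2) :: t)).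
have [v1 Hv1] := B2 _ nv.
have [] := B1 v1.
  have [_ _ H] := local_bf_atom Hv1
    (mem_behead (s := (v1, v) :: _) (map_f (fun x => (x.1.2, x.2)) ta)) (mem_head _ _).
  by rewrite (H rho).
by move=> v2 Hv2; exists v2; apply: (IH ((v2, v1, v) :: t)).
Qed.

Definition swap (a : V * V) := (a.2, a.1).

Lemma local_bf_swap rho q p :
  local_bf rho q p -> local_bf rho q [seq swap a | a <- p].
Proof.
elim: q p => [|q IH] p [A S]; (split; first
  (by move=> _ _ /mapP[a pa ->] /mapP[b pb ->] /=;
   have [H1 H2 H3] := A _ _ pa pb; split=> // d /H3)) => //.
move=> _ /mapP[a pa ->] /=; have [F B] := S _ pa; split=> v.
  by move=> /B[v' H]; exists v'; apply: (IH ((v', v) :: p)).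
by move=> /F[v' H]; exists v'; apply: (IH ((v, v') :: p)).
Qed.

Hypothesis Rsym : symmetric R.

Definition far d p1 p2 := forall a b, a \in p1 -> b \in p2 ->
  ~~ near R d a.1 b.1 /\ ~~ near R d a.2 b.2.

(** The two games are played independently: each round brings the sides closer by at most [rho], so
    after [q] rounds they are still more than [rho] apart, and no atomic condition links them. *)
Lemma local_bf_cat rho q p1 p2 : 0 < rho -> far (rho * q.+1) p1 p2 ->
  local_bf rho q p1 -> local_bf rho q p2 -> local_bf rho q (p1 ++ p2).
Proof.
move=> rho0.
have atomcat q' (q1 q2 : seq (V * V)) : far (rho * q'.+1) q1 q2 ->
    local_atom rho q1 -> local_atom rho q2 -> local_atom rho (q1 ++ q2).
  move=> fr A1 A2.
  have fr1 d a b : d <= rho -> a \in q1 -> b \in q2 ->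
      near R d a.1 b.1 = false /\ near R d a.2 b.2 = false.
    move=> ld aq bq; have [] := fr _ _ aq bq.
    by move=> f1 f2; split; apply/negbTE; [move: f1|move: f2]; apply: contra;
      apply: near_leq; nia.
  have frR a b : a \in q1 -> b \in q2 -> R a.1 b.1 = false /\ R a.2 b.2 = false.
    move=> aq bq; have [H1 H2] := fr1 1 _ _ rho0 aq bq.
    split; [move: H1|move: H2]; apply: contraFF => H;
      by apply: near_step H (near_refl _ _ _).
  move=> a b; rewrite !mem_cat => /orP[aq|aq] /orP[bq|bq].
  - exact: A1.
  - have [H _ _] := A1 _ _ aq aq; have [H1 H2] := frR _ _ aq bq; split=> //.
      by rewrite H1 H2.
    by move=> d ld; have [-> ->] := fr1 _ _ _ ld aq bq.
  - have [H _ _] := A2 _ _ aq aq; have [H1 H2] := frR _ _ bq aq; split=> //.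
      by rewrite Rsym H1 Rsym H2.
    move=> d ld; rewrite near_sym // [RHS]near_sym //.
    by have [-> ->] := fr1 _ _ _ ld bq aq.
  - exact: A2.
elim: q p1 p2 => [|q IH] p1 p2 fr [A1 S1] [A2 S2]; split=> //;
  try exact: (atomcat _ _ _ fr).
have le1 : rho * q.+1 <= rho * q.+2 by nia.
(* Extending one side by a vertex within rho of it keeps the two sides far. *)
have H1 a b : a \in p1 -> local_bf rho q (b :: p1) ->
    near R rho a.1 b.1 || near R rho a.2 b.2 -> local_bf rho q (b :: p1 ++ p2).
  move=> ap Hb nb; apply: (IH (b :: p1)) => //; last first.
    by apply: local_bf_pred; split.
  have {nb}[nb1 nb2] : near R rho a.1 b.1 /\ near R rho a.2 b.2.
    have [_ _ H] := local_bf_atom Hb (mem_behead (s := b :: _) ap) (mem_head _ _).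
    by move: nb; rewrite H // orbb.
  move=> c d; rewrite inE => /predU1P[->|cp] dp.
    have [f1 f2] := fr _ _ ap dp; split; [move: f1|move: f2]; apply: contra.
      by move/(near_trans nb1); rewrite (_ : _ + _ = rho * q.+2) //; nia.
    by move/(near_trans nb2); rewrite (_ : _ + _ = rho * q.+2) //; nia.
  by have [f1 f2] := fr _ _ cp dp; split; [move: f1|move: f2]; apply: contra;
    apply: near_leq.
have H2 a b : a \in p2 -> local_bf rho q (b :: p2) ->
    near R rho a.1 b.1 || near R rho a.2 b.2 -> local_bf rho q (b :: p1 ++ p2).
  move=> ap Hb nb.
  apply: (@local_bf_sub _ _ (p1 ++ b :: p2)).
    by move=> z; rewrite !(inE, mem_cat) orbCA.
  apply: IH => //; last by apply: local_bf_pred; split.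
  have {nb}[nb1 nb2] : near R rho a.1 b.1 /\ near R rho a.2 b.2.
    have [_ _ H] := local_bf_atom Hb (mem_behead (s := b :: _) ap) (mem_head _ _).
    by move: nb; rewrite H // orbb.
  move=> c d cp; rewrite inE => /predU1P[->|dp].
    have [f1 f2] := fr _ _ cp ap; split; [move: f1|move: f2]; apply: contra.
      by rewrite near_sym // => /(near_trans nb1);
        rewrite (_ : _ + _ = rho * q.+2) 1?near_sym //; nia.
    by rewrite near_sym // => /(near_trans nb2);
        rewrite (_ : _ + _ = rho * q.+2) 1?near_sym //; nia.
  by have [f1 f2] := fr _ _ cp dp; split; [move: f1|move: f2]; apply: contra;
    apply: near_leq.
move=> a; rewrite mem_cat => /orP[ap|ap].
  have [F B] := S1 _ ap; split=> v nv.
    by have [v' H] := F _ nv; exists v'; apply: H1 ap H _; rewrite nv.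
  by have [v' H] := B _ nv; exists v'; apply: H1 ap H _; rewrite nv orbT.
have [F B] := S2 _ ap; split=> v nv.
  by have [v' H] := F _ nv; exists v'; apply: H2 ap H _; rewrite nv.
by have [v' H] := B _ nv; exists v'; apply: H2 ap H _; rewrite nv orbT.
Qed.

Lemma local_bf_diag rho q p :
  (forall a, a \in p -> a.1 = a.2) -> local_bf rho q p.
Proof.
elim: q p => [|q IH] p dp; (split; first by move=> a b /dp -> /dp ->) => //.
move=> a ap; split=> v _; exists v; apply: IH => b; rewrite inE.
  by case/predU1P=> [->|/dp].
by case/predU1P=> [->|/dp].
Qed.

Lemma local_bf_extend rho q p (xs : seq V) :
  local_bf rho (q + size xs) p ->
  (forall x, x \in xs -> exists2 a, a \in p & near R rho a.2 x) ->
  exists2 ys, size ys = size xs & local_bf rho q (zip ys xs ++ p).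
Proof.
elim: xs q => [|x xs IH] q H Hx; first by exists [::] => //; rewrite addn0 in H.
have [||ys sy Hy] := IH q.+1; first by rewrite addSnnS.
  by move=> y yx; apply: Hx; rewrite inE yx orbT.
have [a ap na] := Hx _ (mem_head _ _).
have [_ /(_ a)[|_ /(_ _ na)[y Hxy]]] := Hy; first by rewrite mem_cat ap orbT.
by exists (y :: ys) => //=; rewrite sy.
Qed.

(* If every vertex of the local type of [c] were close to the right-hand side,
   then pulling a scattered family of such vertices back to the left-hand side
   and adding [c] would yield larger and larger scattered families, each of
   which has at most [size p] members. *)
Lemma local_bf_far_reply r rho q rho' q' n p c :
  local_bf rho q p -> size p <= n -> rho' <= rho -> 3 * r <= rho ->
  q' + n.+1 <= q ->
  (forall a, a \in p -> ~~ near R rho a.1 c) ->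
  exists d, local_bf rho' q' [:: (c, d)] /\ forall a, a \in p -> ~~ near R r a.2 d.
Proof.
move=> Hp sp lrho lr lq cfar.
pose close x := has (fun a => near R r a.2 x) p.
pose theta x := local_bf rho' q' [:: (c, x)].
pose scat := pairwise (fun x y => ~~ near R (2 * r) x y).
pose goal := exists d, theta d /\ forall a, a \in p -> ~~ near R r a.2 d.
have pick xs : (forall x, x \in xs -> theta x) -> goal \/ all close xs.
  move=> Hxs; case: (boolP (all close xs)) => [|/allPn[x xxs nx]]; first by right.
  by left; exists x; split; [exact: Hxs|move=> a; move/hasPn: nx; apply].
suff /(_ n.+1 (leqnn _))[//|[xs [sx thx scx]]] : forall m, m <= n.+1 -> goal \/
    exists xs, [/\ size xs = m, forall x, x \in xs -> theta x & scat xs].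
  have [//|cx] := pick _ thx.
  (* Each member of the family is sent to the first pair of [p] that it is close to. Two members
     more than [2 * r] apart cannot share a pair. *)
  pose g x := nth (c, c) p (find (fun a => near R r a.2 x) p).
  have gn x : x \in xs -> near R r (g x).2 x.
    by move=> /(allP cx) xc; apply: nth_find xc.
  have ug : uniq (map g xs).
    rewrite uniq_pairwise pairwise_map; apply: (sub_in_pairwise (P := mem xs)) scx.
      move=> x y xxs yxs; apply: contraNneq => gxy; rewrite mul2n -addnn.
      have nx : near R r x (g y).2 by rewrite -gxy (near_sym Rsym) gn.
      exact: near_trans nx (gn _ yxs).
    exact/allP.
  have : size (map g xs) <= size p.
    apply: uniq_leq_size ug _ => _ /mapP[x xxs ->].
    by apply: mem_nth; rewrite -has_find; apply: (allP cx).
  by rewrite size_map sx; lia.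
elim=> [_|m IH lm]; first by right; exists [::].
have [||[xs [sx thx scx]]] := IH; [by lia|by left|].
have [|cx] := pick _ thx; first by left.
have lrr : r <= rho by lia.
have [||ys sy Hy] := @local_bf_extend rho (q - size xs) p xs.
- by rewrite subnK //; lia.
- by move=> x /(allP cx)/hasP[a ap na]; exists a => //; apply: near_leq na.
have zy i : i < m -> (nth c ys i, nth c xs i) \in zip ys xs ++ p.
  move=> im; rewrite mem_cat -nth_zip ?sy // mem_nth //.
  by rewrite size_zip sy minnn sx.
have nearE d a b : d <= rho -> a \in zip ys xs ++ p -> b \in zip ys xs ++ p ->
    near R d a.1 b.1 = near R d a.2 b.2.
  by move=> ld aq bq; have [_ _ ->] := local_bf_atom Hy aq bq.
(* [c] is more than [rho >= 3 * r] away from the left-hand side while each reply is within [r] of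
   it, so [c] is more than [2 * r] away from the replies. *)
right; exists (c :: ys).
have cy y : y \in ys -> ~~ near R (2 * r) c y /\ theta y.
  move=> yy; rewrite -(nth_index c yy); set i := index y ys.
  have im : i < m by rewrite -sx -sy index_mem.
  have xm : nth c xs i \in xs by rewrite mem_nth // sx.
  split.
    have /hasP[a ap na] := allP cx _ xm.
    have na1 : near R r a.1 (nth c ys i).
      by rewrite (nearE r a _ lrr _ (zy i im)) // mem_cat ap orbT.
    apply: contra (cfar _ ap); rewrite near_sym // => nc.
    by apply: near_leq (near_trans na1 nc); lia.
  apply: (local_bf_trans (t := [:: (c, nth c xs i, nth c ys i)])).
    exact: thx.
  apply: (@local_bf_swap _ _ [:: (nth c ys i, nth c xs i)]).
  apply: local_bf_leq lrho _ (local_bf_sub _ Hy); first by lia.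
  by move=> z; rewrite inE => /eqP->; apply: zy.
split; first by rewrite /= sy sx.
- move=> y; rewrite inE => /predU1P[->|/cy[]//].
  by apply: local_bf_diag => a; rewrite inE => /eqP->.
rewrite /scat /=; apply/andP; split; first by apply/allP => y /cy[].
apply/(pairwiseP c) => i j; rewrite !inE sy sx => im jm ij.
rewrite (nearE _ (_, _) (_, _) _ (zy i im) (zy j jm)); last by lia.
by apply: (pairwiseP c scx); rewrite ?inE ?sx.
Qed.

(** Radius and depth of the local types that have to agree when [k] rounds remain and at most [n]
    pairs are ever played. The factor 3 and the summand [n.+1] are what [local_bf_far_reply] asks
    for when its [r] is [rho * q.+1], the separation required by [local_bf_cat]. *)
Fixpoint radius_depth n k : nat * nat :=
  if k is k'.+1 then
    let: (rho, q) := radius_depth n k' in (3 * (rho * q.+1), q + n.+1)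
  else (1, 0).

Lemma radius_gt0 n k : 0 < (radius_depth n k).1.
Proof. by elim: k => //= k; case: radius_depth => rho q /=; lia. Qed.

Definition gaifman_bf n k p :=
  size p + k <= n /\
  local_bf (radius_depth n k).1 (radius_depth n k).2 p.

Lemma gaifman_bf_swap n k p :
  gaifman_bf n k p -> gaifman_bf n k [seq swap a | a <- p].
Proof. by case=> sp H; split; [rewrite size_map|apply: local_bf_swap]. Qed.

(** Gaifman's argument: a vertex close to the position is answered in the local game, a distant one
    by a distant vertex of the same local type, which [local_bf_cat] then joins to the position. *)
Lemma gaifman_bf_forth n k p v :
  gaifman_bf n k.+1 p -> exists v', gaifman_bf n k ((v, v') :: p).
Proof.
rewrite /gaifman_bf /=; have := radius_gt0 n k.
case: (radius_depth n k) => rho q /= rho0 [sp Hp].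
have sp' v' : size ((v, v') :: p) + k <= n by rewrite /=; lia.
case: (boolP (has (fun a => near R (3 * (rho * q.+1)) a.1 v) p)) => [/hasP[a ap na]|].
  have [_ H] : local_bf (3 * (rho * q.+1)) (q + n).+1 p by rewrite -addnS.
  have [F _] := H _ ap; have [v' Hv'] := F _ na.
  by exists v'; split; [exact: (sp' v')|]; apply: local_bf_leq _ _ Hv'; nia.
move=> /hasPn nv.
have [||||v' [Hv' fv']] :=
  local_bf_far_reply (r := rho * q.+1) (rho' := rho) (q' := q) (n := n) Hp _ _ _ _ nv.
- by lia.
- by nia.
- by [].
- by lia.
exists v'; split; first exact: (sp' v').
apply: (@local_bf_cat _ _ [:: (v, v')]) => //.
  move=> a b; rewrite inE => /eqP-> bp /=; split; rewrite near_sym ?fv' //.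
  by apply: contra (nv _ bp); apply: near_leq; lia.
by apply: local_bf_leq _ _ Hp; nia.
Qed.

Lemma gaifman_bf_back n k p v' :
  gaifman_bf n k.+1 p -> exists v, gaifman_bf n k ((v, v') :: p).
Proof.
move=> /gaifman_bf_swap/(gaifman_bf_forth v')[v /gaifman_bf_swap H].
exists v; move: H; rewrite /= -map_comp (eq_map (g := id)) ?map_id //.
by case.
Qed.

End LocalTypes.

Lemma mem_zip_tuple (V : eqType) n (e e' : n.-tuple V) a :
  a \in zip e e' -> exists i, a = (tnth e i, tnth e' i).
Proof.
move=> /(nthP a)[i]; rewrite size_zip !size_tuple minnn => lt_in <-.
exists (Ordinal lt_in); case: a => x y.
by rewrite nth_zip ?size_tuple // (tnth_nth x) (tnth_nth y).
Qed.

(** [T] does not depend on the graph, which makes pigeonhole arguments on local types uniform over a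
    class. By recursion on [q], a type records the atomic data and, at each coordinate, the types of
    the extensions by vertices within [rho] of it. *)
Lemma local_bf_index (K : finType) rho q n : exists T : finType,
  forall (V : finType) (R : rel V) (col : V -> K), exists f : n.-tuple V -> T,
  forall e e', f e = f e' -> local_bf R col rho q (zip e e').
Proof.
pose T0 m : finType := ({ffun 'I_m -> K} * {ffun 'I_m * 'I_m -> bool} *
  {ffun 'I_m * 'I_m * 'I_rho.+1 -> bool})%type.
pose f0 m (V : finType) (R : rel V) (col : V -> K) (e : m.-tuple V) : T0 m :=
  ([ffun i => col (tnth e i)], [ffun ij : 'I_m * 'I_m => R (tnth e ij.1) (tnth e ij.2)],
   [ffun ijd : 'I_m * 'I_m * 'I_rho.+1 => near R ijd.2 (tnth e ijd.1.1) (tnth e ijd.1.2)]).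
have f0P m V R col e e' : f0 m V R col e = f0 m V R col e' ->
    local_atom R col rho (zip e e').
  case=> /ffunP H1 /ffunP H2 /ffunP H3 a b.
  move=> /mem_zip_tuple[i ->] /mem_zip_tuple[j ->] /=; split.
  - by have := H1 i; rewrite !ffunE.
  - by have := H2 (i, j); rewrite !ffunE.
  move=> d ld; have := H3 (i, j, inord d).
  by rewrite !ffunE /= inordK.
elim: q n => [|q IH] n.
  exists (T0 n) => V R col; exists (@f0 n V R col) => e e' /f0P H.
  by split.
have [T HT] := IH n.+1.
exists (T0 n * {ffun 'I_n -> {set T}})%type => V R col.
have [f Hf] := HT V R col.
pose near_types (e : n.-tuple V) i :=
  [set f [tuple of v :: e] | v in [pred v | near R rho (tnth e i) v]].
exists (fun e => (f0 n V R col e, [ffun i => near_types e i])) => e e'.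
case=> E1 E2 E3 /ffunP H; split; first by apply: f0P; rewrite /f0 E1 E2 E3.
move=> a /mem_zip_tuple[i ->] /=; split=> v nv.
  have: f [tuple of v :: e] \in near_types e' i.
    by have := H i; rewrite !ffunE => <-; apply: imset_f.
  by case/imsetP=> v' _ /Hf; exists v'.
have: f [tuple of v :: e'] \in near_types e i.
  by have := H i; rewrite !ffunE => ->; apply: imset_f.
by case/imsetP=> v' _ /esym/Hf; exists v'.
Qed.

(** * Uniform quasi-wideness excludes half-graphs *)

Lemma pigeonhole (T I : finType) (f : I -> T) (A : {set I}) m :
  #|T| * m < #|A| -> exists t, m < #|[set i in A | f i == t]|.
Proof.
move=> lt_A; apply/existsP; apply: contraLR lt_A => /existsPn Hm.
rewrite -leqNgt -sum1_card (partition_big f predT) //=.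
rewrite -sum_nat_const leq_sum // => t _.
have := Hm t; rewrite -leqNgt; apply: leq_trans.
by rewrite sum1dep_card; apply: eq_leq; apply: eq_card => i; rewrite !inE.
Qed.

(** Keep an element, discard it together with its at most [d] conflicts, and repeat. *)
Lemma greedy_independent (I : finType) (c : rel I) d m (A : {set I}) :
  symmetric c -> (forall a, a \in A -> #|[set b in A | c a b]| <= d) ->
  m * d.+1 <= #|A| -> exists2 A' : {set I}, A' \subset A &
    m <= #|A'| /\ {in A' &, forall a b, a != b -> ~~ c a b}.
Proof.
move=> csym; elim: m A => [|m IH] A dA leA.
  by exists set0; [apply: sub0set|split=> // a b; rewrite inE].
have [a aA] : exists a, a \in A by apply/card_gt0P; lia.
pose N := [set b in A | c a b]; pose B := A :\: (a |: N).
have BA : B \subset A by apply: subsetDl.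
have cN : #|a |: N| <= d.+1.
  by rewrite cardsU1; have := dA _ aA; rewrite -/N; case: (_ \notin _) => /=; lia.
have cB : #|A| <= #|B| + #|a |: N|.
  by rewrite -(cardsID (a |: N) A) addnC leq_add2l subset_leq_card ?subsetIr.
have [||A' A'B [mA' indA']] := IH B; last first.
- exists (a |: A').
    by rewrite subUset sub1set aA (subset_trans A'B).
  split=> [|x y].
    rewrite cardsU1; case: (boolP (a \in A')) => [/(subsetP A'B)|_] /=; last by lia.
    by rewrite !inE eqxx.
  have nA' z : z \in A' -> ~~ c a z.
    move=> /(subsetP A'B); rewrite !inE => /andP[+ zA].
    by rewrite zA negb_or => /andP[].
  rewrite !in_setU1 => /predU1P[->|xA] /predU1P[->|yA] //; rewrite ?eqxx //.
  + by move=> _; apply: nA'.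
  + by move=> _; rewrite csym; apply: nA'.
  + exact: indA'.
- by lia.
move=> b bB; apply: leq_trans (dA b (subsetP BA _ bB)); apply: subset_leq_card.
by apply/subsetP => z; rewrite !inE => /andP[/andP[_ ->] ->].
Qed.

(** * Games for formulas on copied and coloured graphs *)

Fixpoint rank U n (phi : formula U n) : nat :=
  match phi with
  | FNot _ phi => rank phi
  | FAnd _ phi psi => maxn (rank phi) (rank psi)
  | FEx _ phi => (rank phi).+1
  | _ => 0
  end.

Fixpoint colors_of U n (phi : formula U n) : seq U :=
  match phi with
  | FColor _ u _ => [:: u]
  | FNot _ phi => colors_of phi
  | FAnd _ phi psi => colors_of phi ++ colors_of psi
  | FEx _ phi => colors_of phi
  | _ => [::]
  end.

(** The type of colours has no decidable equality, so inclusion of the colours of [phi] in [cs] is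
    replaced by occurrence as a contiguous factor. *)
Definition covers U (cs : seq U) n (phi : formula U n) :=
  exists s1 s2, cs = s1 ++ colors_of phi ++ s2.

(** A back-and-forth system on [G] lifts to [copy k G]: a move in copy [i] is answered in copy [i],
    since adjacency there depends only on the copy indices and on equality and adjacency in [G]. *)
Lemma sat_back_forth (G : sgraph) k U (c : U -> {set copy k G}) (cs : seq U)
    (Z : nat -> seq (G * G) -> Prop) :
  (forall q p v, Z q.+1 p -> exists v', Z q ((v, v') :: p)) ->
  (forall q p v', Z q.+1 p -> exists v, Z q ((v, v') :: p)) ->
  (forall q p a b, Z q p -> a \in p -> b \in p ->
    [/\ (a.1 == b.1) = (a.2 == b.2), adj a.1 b.1 = adj a.2 b.2 &
        forall i (j : 'I_(size cs)), ((i, a.1) \in c (tnth (in_tuple cs) j)) =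
                    ((i, a.2) \in c (tnth (in_tuple cs) j))]) ->
  forall n (phi : formula U n) q p (e e' : n.-tuple (copy k G)),
  covers cs phi -> rank phi <= q -> Z q p ->
  (forall i, (tnth e i).1 = (tnth e' i).1 /\
             ((tnth e i).2, (tnth e' i).2) \in p) ->
  sat (G := ColoredGraph c) phi e = sat (G := ColoredGraph c) phi e'.
Proof.
move=> Zf Zb Za n; elim=> {n} [n i j|n i j|n u i|n phi IH|n phi IH1 psi IH2|n phi IH]
  q p e e' cv rk Zp He /=.
- have [[Hi pi] [Hj pj]] := (He i, He j); have [H _ _] := Za _ _ _ _ Zp pi pj.
  by move: Hi Hj H; case: (tnth e i) (tnth e j) (tnth e' i) (tnth e' j)
    => [? ?] [? ?] [? ?] [? ?] /= -> ->; rewrite !xpair_eqE => ->.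
- have [[Hi pi] [Hj pj]] := (He i, He j); have [H1 H2 _] := Za _ _ _ _ Zp pi pj.
  by rewrite /copy_adj Hi Hj H1 H2.
- have [Hi pi] := He i; have [_ _ H] := Za _ _ _ _ Zp pi pi.
  have [s1 [s2 /= Ecs]] := cv.
  have lt : size s1 < size cs by rewrite Ecs size_cat /=; lia.
  have Eu : tnth (in_tuple cs) (Ordinal lt) = u.
    by rewrite (tnth_nth u) /= Ecs nth_cat ltnn subnn.
  move: Hi (H (tnth e i).1 (Ordinal lt)); rewrite Eu /=.
  by case: (tnth e i) (tnth e' i) => [? ?] [? ?] /= ->.
- by rewrite (IH q p e e').
- have [s1 [s2 Ecs]] := cv; move: rk => /=; rewrite geq_max => /andP[rk1 rk2].
  rewrite (IH1 q p e e') ?(IH2 q p e e') //.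
    by exists (s1 ++ colors_of phi), s2; rewrite Ecs /= !catA.
  by exists s1, (colors_of psi ++ s2); rewrite Ecs /= !catA.
case: q Zp rk => [|q] Zp rk //.
apply/existsP/existsP => -[[i v] Hv].
  have [v' Zv] := Zf _ _ v Zp; exists (i, v').
  rewrite -(IH q ((v, v') :: p) [tuple of (i, v) :: e]) // => j.
  case: (unliftP ord0 j) => [j' ->|->]; rewrite ?tnth0 ?tnthS /=.
    by rewrite inE; have [-> ->] := He j'; rewrite orbT.
  by rewrite mem_head.
have [v' Zv] := Zb _ _ v Zp; exists (i, v').
rewrite (IH q ((v', v) :: p) _ [tuple of (i, v) :: e']) // => j.
case: (unliftP ord0 j) => [j' ->|->]; rewrite ?tnth0 ?tnthS /=.
  by rewrite inE; have [-> ->] := He j'; rewrite orbT.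
by rewrite mem_head.
Qed.

(** Deleted vertices are isolated rather than removed, which keeps the vertex type fixed. *)
Definition del (G : finType) (R : rel G) (S : {set G}) : rel G :=
  fun x y => [&& R x y, x \notin S & y \notin S].

Lemma del_sym (G : finType) (R : rel G) S : symmetric R -> symmetric (del R S).
Proof. by move=> Rs x y; rewrite /del Rs andbCA andbC -andbA andbCA. Qed.

Lemma del_sub (G : finType) (R : rel G) (S S' : {set G}) :
  S \subset S' -> subrel (del R S') (del R S).
Proof.
move=> /subsetP SS' x y /and3P[xy xS yS].
by rewrite /del xy (contra (@SS' x)) ?(contra (@SS' y)).
Qed.

Definition scattered (G : finType) (R : rel G) r (A : {set G}) :=
  {in A &, forall x y, x != y -> ~~ near R r x y}.

Definition quasi_wide (G : finType) (R : rel G) r g m N :=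
  forall A : {set G}, N <= #|A| -> exists S A' : {set G},
  [/\ #|S| <= g, A' \subset A, m <= #|A'|, [disjoint A' & S] &
      scattered (del R S) r A'].

Lemma quasi_wide_family (G : finType) (R : rel G) r g m N (I : finType)
    (f : I -> G) (J : {set I}) :
  quasi_wide R r g m N -> {in J &, injective f} -> N <= #|J| ->
  exists (S : {set G}) (J' : {set I}), [/\ #|S| <= g, J' \subset J, m <= #|J'|,
    {in J', forall i, f i \notin S} &
    {in J' &, forall i j, i != j -> ~~ near (del R S) r (f i) (f j)}].
Proof.
move=> qw injf NJ; have [|S [A' [Sg A'J mA' dis sc]]] := qw (f @: J).
  by rewrite card_in_imset.
exists S, [set i in J | f i \in A']; split=> //.
- by apply/subsetP => i; rewrite inE => /andP[].
- apply: leq_trans mA' (leq_trans _ (leq_imset_card f _)).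
  apply/subset_leq_card/subsetP => x xA'; have /imsetP[i iJ Ex] := subsetP A'J _ xA'.
  by apply/imsetP; exists i => //; rewrite inE iJ -Ex.
- by move=> i; rewrite inE => /andP[_ /(disjointFr dis)->].
move=> i j; rewrite !inE => /andP[iJ fi] /andP[jJ fj] ij; apply: sc => //.
by apply: contra ij => /eqP/injf->.
Qed.

(** The number [g] of deleted vertices is fixed before the size [m] of the scattered set. This order
    matters below, where [m] is chosen from a number of types that depends on [g]. *)
Definition uniformly_quasi_wide (D : sgraph -> Prop) :=
  forall r, exists g, forall m, exists N, forall G, D G -> quasi_wide (@adj G) r g m N.

(** After a few deletions there are indices [i != j] such that [x i] and [x j] have the same local
    type, so do [y i] and [y j], and both crossed pairs are far apart. By Gaifman locality [eta]
    cannot tell [(x i, y j)] from [(x j, y i)], although only one of [i <= j] and [j <= i] holds. *)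
Theorem quasi_wide_no_half_graph (D : sgraph -> Prop) k U (eta : formula U 2) :
  uniformly_quasi_wide D -> exists N, forall (G : sgraph) (c : U -> {set copy k G})
    (x y : 'I_N -> copy k G), D G ->
  ~ forall i j, sat2 (ColoredGraph c) eta (x i) (y j) = (i <= j).
Proof.
move=> uqw; pose cs := colors_of eta; pose q := rank eta.
(* At most [q.+2] pairs are played: two for the free variables and one per nested quantifier. *)
have := @radius_gt0 q.+2 q; case Erq: (radius_depth q.+2 q) => [rho Q] /= rho0.
pose r := rho * Q.+1.
have [g Hg] := uqw (2 * r).
(* Two applications of quasi-wideness delete at most [g + g] vertices. The second component gives
   each of them a slot recording equality with it and adjacency to it, so that adjacency in [G] can
   be restored from colours. *)
pose K : finType := ({ffun 'I_k * 'I_(size cs) -> bool} *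
  {ffun 'I_(g + g) -> bool * bool})%type.
have [T HT] := local_bf_index K rho Q 1.
have [N1 HN1] := Hg (#|{: T * T}| * 6).+1.
have [N2 HN2] := Hg N1.
exists (#|{: 'I_k * 'I_k}| * N2).+1 => G c x y DG half.
have xinj : injective x.
  move=> i j Ex; apply/val_inj/eqP; rewrite eqn_leq.
  by rewrite -(half i j) Ex half -(half j i) -Ex half !leqnn.
have yinj : injective y.
  move=> i j Ey; apply/val_inj/eqP; rewrite eqn_leq.
  by rewrite -(half i j) -Ey half -(half j i) Ey half !leqnn.
have [|[c1 c2]] := @pigeonhole _ _ (fun i => ((x i).1, (y i).1)) setT N2.
  by rewrite cardsT card_ord.
set I0 := [set i in _ | _] => sI0.
have cI0 i : i \in I0 -> (x i).1 = c1 /\ (y i).1 = c2.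
  by rewrite !inE => /eqP[].
have x2inj : {in I0 &, injective (fun i => (x i).2)}.
  move=> i j /cI0[xi _] /cI0[xj _] E; apply: xinj.
  by rewrite (surjective_pairing (x i)) (surjective_pairing (x j)) xi xj E.
have y2inj : {in I0 &, injective (fun i => (y i).2)}.
  move=> i j /cI0[_ yi] /cI0[_ yj] E; apply: yinj.
  by rewrite (surjective_pairing (y i)) (surjective_pairing (y j)) yi yj E.
have [S1 [I1 [S1g I10 sI1 _ sc1]]] := quasi_wide_family (HN2 G DG) x2inj (ltnW sI0).
have [S2 [I2 [S2g I21 sI2 _ sc2]]] := quasi_wide_family (HN1 G DG)
  (sub_in2 (subsetP I10) y2inj) sI1.
pose S := S1 :|: S2; pose e := enum S; pose R := del (@adj G) S.
have se : size e <= g + g.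
  by rewrite -cardE (leq_trans (leq_card_setU _ _)) // leq_add.
have Rsym : symmetric R by apply: del_sym; apply: adj_sym.
pose col v : K := ([ffun ij => (ij.1, v) \in c (tnth (in_tuple cs) ij.2)],
  [ffun i : 'I_(g + g) => ((i < size e) && (nth v e i == v),
                            (i < size e) && adj (nth v e i) v)]).
have [f Hf] := HT G R col.
have [t] := @pigeonhole _ _ (fun i => (f [tuple (x i).2], f [tuple (y i).2])) I2 6 sI2.
set I3 := [set i in _ | _] => sI3.
have I32 i : i \in I3 -> i \in I2 by rewrite inE => /andP[].
have I31 i : i \in I3 -> i \in I1 by move/I32/(subsetP I21).
have I30 i : i \in I3 -> i \in I0 by move/I31/(subsetP I10).
(* The remaining [x i] are pairwise more than [2 * r] apart, and so are the [y i]. Hence at most one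
   [y j] is near a given [x i] and conversely, which leaves at most two conflicts per index; two
   independent indices thus need [2 * 3 = 6] candidates. *)
pose cf i j := near R r (x i).2 (y j).2 || near R r (x j).2 (y i).2.
have nearS (S' : {set G}) d u v : S' \subset S -> near R d u v -> near (del (@adj G) S') d u v.
  by move=> sS; apply: near_sub; apply: del_sub.
have [|||I4 I43 [sI4 ind]] := @greedy_independent _ cf 2 2 I3.
- by move=> i j; rewrite /cf orbC.
- move=> i i3.
  apply: (@leq_trans #|[set j in I3 | near R r (x i).2 (y j).2] :|:
                     [set j in I3 | near R r (x j).2 (y i).2]|).
    apply/subset_leq_card/subsetP => j; rewrite !inE => /andP[-> /orP[->|->]] //.
    by rewrite orbT.
  apply: leq_trans (leq_card_setU _ _) _; apply: (@leq_add _ _ 1 1).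
    apply/card_le1_eqP => j l; rewrite inE => /andP[/I32 j2 nj];
      rewrite inE => /andP[/I32 l2 nl].
    apply: contraTeq nl => jl; have /= := sc2 _ _ l2 j2 jl; apply: contra => nl.
    apply: (@nearS S2); first exact: subsetUr.
    by rewrite mul2n -addnn; apply: near_trans nj; rewrite (near_sym Rsym).
  apply/card_le1_eqP => j l; rewrite inE => /andP[/I31 j2 nj];
      rewrite inE => /andP[/I31 l2 nl].
  apply: contraTeq nl => jl; have /= := sc1 _ _ l2 j2 jl; apply: contra => nl.
  apply: (@nearS S1); first exact: subsetUl.
  by rewrite mul2n -addnn; apply: near_trans nl _; rewrite (near_sym Rsym).
- exact: ltnW.
have [i [j [i4 j4 ij]]] : exists i j, [/\ i \in I4, j \in I4 & i != j].
  by move: sI4 => /card_gt1P[i [j [? ? ?]]]; exists i, j.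
have [i3 j3] := (subsetP I43 _ i4, subsetP I43 _ j4).
have [Ex Ey] : f [tuple (x i).2] = f [tuple (x j).2] /\
               f [tuple (y j).2] = f [tuple (y i).2].
  move: i3 j3; rewrite !inE => /andP[_ /eqP Ei] /andP[_ /eqP Ej].
  by move: Ei; rewrite -Ej => -[-> ->].
have : ~~ cf i j by apply: ind.
rewrite negb_or => /andP[nij nji].
have bf : gaifman_bf R col q.+2 q
    [:: ((x i).2, (x j).2); ((y j).2, (y i).2)].
  split; first by rewrite [size _]/= add2n.
  rewrite Erq /=.
  apply: (@local_bf_cat _ _ _ _ Rsym _ _ [:: _]) => //.
  - by move=> a b; rewrite !inE => /eqP-> /eqP->.
  - exact: (Hf _ _ Ex).
  exact: (Hf _ _ Ey).
suff : sat2 (@ColoredGraph _ (copy k G) c) eta (x i) (y j) =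
       sat2 (@ColoredGraph _ (copy k G) c) eta (x j) (y i).
  rewrite !half => E; move: ij; rewrite -val_eqE eqn_leq -E andbb.
  by case/orP: (leq_total i j) => H; rewrite ?H // E H.
apply: (sat_back_forth (cs := cs) (Z := gaifman_bf R col q.+2)) bf _ => //.
- exact: gaifman_bf_forth.
- exact: gaifman_bf_back.
- move=> q' p a b [_ /local_bf_atom at_] ap bp.
  have [Ca Ra Na] := at_ _ _ ap bp; have [Cb _ _] := at_ _ _ bp bp.
  split.
  + exact: (Na 0).
  + have inS v v' : col v = col v' -> v \in S -> v = v'.
      case=> _ /ffunP H vS.
      have iv : index v e < size e by rewrite index_mem mem_enum.
      have := H (Ordinal (leq_trans iv se)); rewrite !ffunE /= iv /=.
      rewrite nth_index ?mem_enum // eqxx => -[/esym/eqP + _].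
      by rewrite (set_nth_default v) // nth_index ?mem_enum.
    have adjS v w w' : col w = col w' -> v \in S -> adj v w = adj v w'.
      case=> _ /ffunP H vS.
      have iv : index v e < size e by rewrite index_mem mem_enum.
      have := H (Ordinal (leq_trans iv se)); rewrite !ffunE /= iv /= => -[_].
      by rewrite !(set_nth_default v _ iv) nth_index ?mem_enum.
    have adjE a1 b1 : a1 \notin S -> b1 \notin S -> adj a1 b1 = R a1 b1.
      by move=> na nb; rewrite /R /del na nb !andbT.
    case: (boolP (a.1 \in S)) => [aS|naS].
      by rewrite -(inS _ _ Ca aS); apply: adjS.
    case: (boolP (b.1 \in S)) => [bS|nbS].
      by rewrite -(inS _ _ Cb bS) adj_sym [RHS]adj_sym; apply: adjS.
    have naS' : a.2 \notin S.
      by apply: contra naS => H; rewrite -(inS _ _ (esym Ca) H).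
    have nbS' : b.2 \notin S.
      by apply: contra nbS => H; rewrite -(inS _ _ (esym Cb) H).
    by rewrite !adjE.
  + by move=> i' j'; case: Ca => /ffunP/(_ (i', j')); rewrite !ffunE.
- by exists [::], [::]; rewrite /cs cats0.
move=> l; have [xi yi] := cI0 _ (I30 _ i3); have [xj yj] := cI0 _ (I30 _ j3).
by case: (unliftP ord0 l) => [l' ->|->]; rewrite ?tnth0 ?tnthS /= ?tnth0 ?ord1 ?tnth0
  /= ?xi ?xj ?yi ?yj !inE eqxx ?orbT.
Qed.

(** * Coloured linear orders *)

Lemma seq_max (T : eqType) (s : seq T) (P : pred T) (g : T -> nat) : has P s ->
  exists x, [/\ x \in s, P x & forall y, y \in s -> P y -> g y <= g x].
Proof.
move=> hP; have ex : exists m, has (fun x => P x && (g x == m)) s.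
  by have /hasP[x xs Px] := hP; exists (g x); apply/hasP; exists x; rewrite ?Px /=.
have ub m : has (fun x => P x && (g x == m)) s -> m <= \max_(x <- s) g x.
  by case/hasP=> x xs /andP[_ /eqP <-]; rewrite leq_bigmax_seq.
case: (ex_maxnP ex ub) => m /hasP[x xs /andP[Px /eqP gx]] maxm.
exists x; split=> // y ys Py; rewrite gx; apply: maxm.
by apply/hasP; exists y; rewrite // Py /=.
Qed.

Section IntervalTypes.
Variables (K : finType) (col : nat -> K).

Fixpoint interval_type q : finType :=
  if q is q'.+1 then {set interval_type q' * K * interval_type q'} else unit.

(** The rank [q] type of the coloured order on the open interval from [a] to [b]; a point played
    inside splits it into two intervals of lower rank. *)
Fixpoint itp q (a b : nat) : interval_type q :=
  match q return interval_type q with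
  | 0 => tt
  | q'.+1 => [set (itp q' a t, col t, itp q' t b) | t : 'I_b & a < t]
  end.

Lemma mem_itp q a b t : a < t < b ->
  (itp q a t, col t, itp q t b) \in itp q.+1 a b.
Proof.
move=> /andP[lt_a lt_b].
by apply/imsetP; exists (Ordinal lt_b); rewrite // inE.
Qed.

Lemma itpP q a b x : x \in itp q.+1 a b ->
  exists2 t, a < t < b & x = (itp q a t, col t, itp q t b).
Proof. by move=> /imsetP[t]; rewrite inE => lt_a ->; exists t; rewrite ?lt_a /=. Qed.

Lemma itp_forth q a b a' b' t : itp q.+1 a b = itp q.+1 a' b' -> a < t < b ->
  exists t', [/\ a' < t' < b', itp q a t = itp q a' t', col t = col t' &
    itp q t b = itp q t' b'].
Proof.
move=> E /(mem_itp q); rewrite E => /itpP[t' lt' [E1 E2 E3]].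
by exists t'.
Qed.

Lemma itp_refl q a b : itp q a a = itp q b b.
Proof.
case: q => [|q] //; apply/setP => x.
by apply/idP/idP => /itpP[t]; lia.
Qed.

Lemma itp_pred q a b a' b' :
  itp q.+1 a b = itp q.+1 a' b' -> itp q a b = itp q a' b'.
Proof.
elim: q a b a' b' => [|q IH] a b a' b' E //.
have half c d c' d' : itp q.+2 c d = itp q.+2 c' d' ->
    itp q.+1 c d \subset itp q.+1 c' d'.
  move=> E'; apply/subsetP => x /itpP[t lt_t ->].
  have [t' [lt_t' /IH -> -> /IH ->]] := itp_forth E' lt_t.
  exact: mem_itp.
by apply/eqP; rewrite eqEsubset !half.
Qed.

(** Composition: a point of the interval lies left of [y], right of [y] or at [y]. It is answered in
    the part that contains it, and the other part is kept at lower rank. *)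
Lemma itp_comp q a y b a' y' b' : a < y < b -> a' < y' < b' ->
  itp q a y = itp q a' y' -> col y = col y' -> itp q y b = itp q y' b' ->
  itp q a b = itp q a' b'.
Proof.
elim: q a y b a' y' b' => [|q IH] a y b a' y' b' // lty lty' E1 E2 E3.
have half c z d c' z' d' : c < z < d -> c' < z' < d' ->
    itp q.+1 c z = itp q.+1 c' z' -> col z = col z' ->
    itp q.+1 z d = itp q.+1 z' d' -> itp q.+1 c d \subset itp q.+1 c' d'.
  move=> ltz ltz' H1 H2 H3; apply/subsetP => x /itpP[t lt_t ->].
  have [H1' H3'] := (itp_pred H1, itp_pred H3).
  case: (ltngtP t z) => [tz|zt|->].
  - have [|t' [lt_t' J1 J2 J3]] := itp_forth (t := t) H1; first by lia.
    rewrite J1 J2 (IH t z d t' z' d') //; try lia.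
    by apply: mem_itp; lia.
  - have [|t' [lt_t' J1 J2 J3]] := itp_forth (t := t) H3; first by lia.
    rewrite J2 J3 (IH c z t c' z' t') //; try lia.
    by apply: mem_itp; lia.
  by rewrite H1' H2 H3'; apply: mem_itp.
by apply/eqP; rewrite eqEsubset (half a y b a' y' b') ?(half a' y' b' a y b).
Qed.

Implicit Types (p : seq (nat * nat)) (x y : nat * nat).

Definition order_bf q p := forall x y, x \in p -> y \in p ->
  [/\ col x.1 = col x.2, (x.1 < y.1) = (x.2 < y.2) &
      x.1 < y.1 -> itp q x.1 y.1 = itp q x.2 y.2].

Lemma order_bf_pred q p : order_bf q.+1 p -> order_bf q p.
Proof.
by move=> H x y xp yp; have [H1 H2 H3] := H _ _ xp yp; split=> // /H3/itp_pred.
Qed.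

Lemma order_bf_cons q x p : order_bf q p -> col x.1 = col x.2 ->
  (forall y, y \in p ->
     [\/ [/\ x.1 < y.1, x.2 < y.2 & itp q x.1 y.1 = itp q x.2 y.2],
         [/\ y.1 < x.1, y.2 < x.2 & itp q y.1 x.1 = itp q y.2 x.2] |
         x = y]) ->
  order_bf q (x :: p).
Proof.
move=> H Ec Hx y z; rewrite !inE => /predU1P[->|yp] /predU1P[->|zp].
- by rewrite !ltnn.
- have [[H1 H2 H3]|[H1 H2 H3]|Exz] := Hx _ zp.
  + by rewrite H1 H2 H3.
  + by split=> //; lia.
  by rewrite -Exz !ltnn.
- have [H0 _ _] := H _ _ yp yp; have [[H1 H2 H3]|[H1 H2 H3]|Exz] := Hx _ yp.
  + by split=> //; lia.
  + by rewrite H1 H2 H3.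
  by rewrite -Exz !ltnn.
exact: H.
Qed.

Lemma order_bf_swap q p :
  order_bf q p -> order_bf q [seq (x.2, x.1) | x <- p].
Proof.
move=> H _ _ /mapP[x xp ->] /mapP[y yp ->] /=.
by have [H1 H2 H3] := H _ _ xp yp; split=> //; rewrite -H2 => /H3.
Qed.

(** A new point lies between two consecutive played points [l] and [u] and is answered in the
    corresponding gap; the types towards all other points follow by composition through [l] or [u].
    The sentinels [(0, 0)] and [(B, B)] ensure that [l] and [u] exist. *)
Lemma order_bf_forth q p B t : order_bf q.+1 p -> (0, 0) \in p -> (B, B) \in p ->
  0 < t < B -> exists2 t', 0 < t' < B & order_bf q ((t, t') :: p).
Proof.
move=> H p0 pB lt_t; have Hq := order_bf_pred H.
case: (boolP (has (fun x => x.1 == t) p)) => [/hasP[[t1 t'] tp /= /eqP Et]|/hasPn nt].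
  rewrite {t1}Et in tp; exists t'.
    by have [_ + _] := H _ _ p0 tp; have [_ + _] := H _ _ tp pB => /=; lia.
  by move=> x y; rewrite !inE => /predU1P[->|xp] /predU1P[->|yp]; apply: Hq.
have [l [lp lt_l lmax]] : exists l : nat * nat, [/\ l \in p, l.1 < t &
    forall y : nat * nat, y \in p -> y.1 < t -> y.1 <= l.1].
  apply: (@seq_max _ p (fun x => x.1 < t) (fun x => x.1)).
  by apply/hasP; exists (0, 0) => //=; lia.
(* The nearest played point on the right maximises [B - x.1]; the bound [x.1 <= B] keeps this
   subtraction from being truncated. *)
have [u [up lt_u umin]] : exists u : nat * nat, [/\ u \in p, t < u.1 <= B &
    forall y : nat * nat, y \in p -> t < y.1 <= B -> B - y.1 <= B - u.1].
  apply: (@seq_max _ p (fun x => t < x.1 <= B) (fun x => B - x.1)).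
  by apply/hasP; exists (B, B) => //=; lia.
have [_ Elu Tlu] := H _ _ lp up.
have [||t' [lt_t' E1 E2 E3]] := itp_forth (t := t) (Tlu _); try lia.
have [_ l0 _] := H _ _ p0 lp; have [_ uB _] := H _ _ up pB.
have [_ Bu _] := H _ _ pB up; move: l0 uB Bu => /= l0 uB Bu.
exists t'; first by lia.
apply: order_bf_cons => // y yp /=.
have yt : y.1 != t by apply: nt.
case: (ltnP y.1 t) => ty.
  apply: Or32; have /= := lmax _ yp ty.
  have [cl yl Tyl] := H _ _ yp lp; have [cl' ly _] := H _ _ lp yp.
  rewrite leq_eqVlt => /orP[/eqP Ey|lt_y].
    have Ey2 : y.2 = l.2 by lia.
    by rewrite Ey Ey2; split=> //; lia.
  split=> //; first by lia.
  by apply: (itp_comp (y := l.1) (y' := l.2)) => //; try lia; exact/itp_pred/Tyl.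
apply: Or31.
have lt_y : t < y.1 by lia.
have uy : u.1 <= y.1.
  case: (leqP y.1 B) => yB; last by lia.
  by have := umin _ yp; rewrite lt_y yB; lia.
have [cu uy' Tuy] := H _ _ up yp; have [cy yu _] := H _ _ yp up.
move: uy; rewrite leq_eqVlt => /orP[/eqP Ey|ltu].
  have Ey2 : y.2 = u.2 by lia.
  by rewrite -Ey Ey2; split=> //; lia.
split=> //; first by lia.
by apply: (itp_comp (y := u.1) (y' := u.2)) => //; try lia; exact/itp_pred/Tuy.
Qed.

Lemma order_bf_back q p B t' : order_bf q.+1 p -> (0, 0) \in p -> (B, B) \in p ->
  0 < t' < B -> exists2 t, 0 < t < B & order_bf q ((t, t') :: p).
Proof.
move=> /order_bf_swap H p0 pB lt_t.
have [||t lt_t0 /order_bf_swap /= Ht] := order_bf_forth H _ _ lt_t.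
- by apply/mapP; exists (0, 0).
- by apply/mapP; exists (B, B).
exists t => //; move: Ht; rewrite -map_comp (eq_map (g := id)) ?map_id //.
by case.
Qed.

End IntervalTypes.

(** * Ramsey's theorem for pairs *)

Lemma pigeonhole_seq (T : finType) (V : Type) (f : V -> T) (s : seq V) m :
  #|T| * m < size s -> exists t, m < size [seq x <- s | f x == t].
Proof.
move=> lt_s; apply/existsP; apply: contraLR lt_s => /existsPn Hm.
rewrite -leqNgt -sum_nat_const.
have -> : size s = \sum_t size [seq x <- s | f x == t].
  elim: s {Hm} => [|x s IH] /=; first by rewrite big1.
  rewrite (bigD1 (f x)) //= eqxx /= addSn IH (bigD1 (f x)) //=.
  congr (_ + _).+1; apply: eq_bigr => t tx.
  by rewrite eq_sym (negbTE tx).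
by apply: leq_sum => t _; have := Hm t; rewrite -leqNgt.
Qed.

(** First an end-homogeneous sequence is built, in which the colour of a pair depends only on its
    earlier element and is stored with it; then the pigeonhole principle is applied to the stored
    colours. *)
Lemma ramsey_pairs (T : finType) m : exists N,
  forall (V : eqType) (chi : V -> V -> T) (s : seq V), N <= size s ->
  exists s' t, [/\ subseq s' s, size s' = m & pairwise (fun x y => chi x y == t) s'].
Proof.
have pre L : exists N, forall (V : eqType) (chi : V -> V -> T) (s : seq V),
    N <= size s -> exists s' : seq (V * T), [/\ subseq (unzip1 s') s,
    size s' = L & pairwise (fun x y => chi x.1 y.1 == x.2) s'].
  elim: L => [|L [N IH]].
    by exists 0 => V chi s _; exists [::]; rewrite sub0seq.
  exists (#|T| * N).+2 => V chi [|x s] //= lt_s.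
  have [t /ltnW/(IH _ chi)[s' [sub sz pw]]] := pigeonhole_seq (chi x) lt_s.
  exists ((x, t) :: s'); split; rewrite /= ?eqxx ?sz //.
    exact: subseq_trans sub (filter_subseq _ _).
  rewrite pw andbT; apply/allP => y ys'.
  have := mem_subseq sub (map_f fst ys').
  by rewrite mem_filter => /andP[].
have [N HN] := pre (#|T| * m).+1.
exists N => V chi s /(HN _ chi)[s' [sub sz pw]].
have [|t lt_m] := @pigeonhole_seq T _ snd s' m; first by rewrite sz.
exists (take m (unzip1 [seq x <- s' | x.2 == t])), t; split.
- apply: subseq_trans (take_subseq _ _) (subseq_trans _ sub).
  exact/map_subseq/filter_subseq.
- by rewrite size_takel // size_map ltnW.
apply: (subseq_pairwise (take_subseq _ _)).
rewrite pairwise_map.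
have := pairwise_filter; move=> /(_ _ _ (fun x => x.2 == t) _ pw).
apply: (sub_in_pairwise (P := fun x => x.2 == t)); last exact: filter_all.
by move=> x y; rewrite !unfold_in /= => /eqP <- _.
Qed.

(** * Biclique-free graphs definable in linear orders *)

(** For intersecting [Y] and [Z] the condition holds by irreflexivity, so only genuine bicliques are
    excluded. *)
Definition no_biclique n (G : sgraph) := forall Y Z : {set G},
  n <= #|Y| -> n <= #|Z| -> exists y z, [/\ y \in Y, z \in Z & ~~ adj y z].

(** An interpretation in a coloured order, stated semantically: [h] gives each vertex a copy index
    and a position, and membership and adjacency are invariant under equality of rank [n] types. The
    single parameter bounds the copies, the letters, the rank and the excluded biclique. *)
Definition word_graph n (G : sgraph) := exists B (col : nat -> 'I_n) (h : G -> 'I_n * nat),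
  [/\ injective h, forall z, 0 < (h z).2 < B,
      forall z t, 0 < t < B ->
        order_bf col n [:: ((h z).2, t); (0, 0); (B, B)] ->
        exists z', h z' = ((h z).1, t),
      forall y z y' z', (h y).1 = (h y').1 -> (h z).1 = (h z').1 ->
        order_bf col n [:: ((h y).2, (h y').2); ((h z).2, (h z').2); (0, 0); (B, B)] ->
        adj y z = adj y' z'
    & no_biclique n G].

(** * Homogeneous blocks of a coloured order *)

Section Blocks.
Variables (n B M : nat) (col : nat -> 'I_n) (a : nat -> nat).
Notation itp := (itp col).
Hypothesis a_mono : forall i j, i < j <= M -> a i < a j.
Hypothesis a_bound : forall i, i <= M -> 0 < a i < B.
Hypothesis a_col : forall i j, i <= M -> j <= M -> col (a i) = col (a j).
Hypothesis a_left : forall i j, i <= M -> j <= M -> itp n.+1 0 (a i) = itp n.+1 0 (a j).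
Hypothesis a_right : forall i j, i <= M -> j <= M -> itp n.+1 (a i) B = itp n.+1 (a j) B.
Hypothesis a_pair : forall i j i' j', i < j <= M -> i' < j' <= M ->
  itp n.+1 (a i) (a j) = itp n.+1 (a i') (a j').

Definition block i v := (i < M) && (a i <= v < a i.+1).

Definition key_type : finType :=
  ('I_n * bool * interval_type 'I_n n * interval_type 'I_n n)%type.

(** The place of [v] inside block [i]. The flag marks the first point of the block, where the left
    interval is empty and composition at [a i] does not apply. *)
Definition key i v : key_type := (col v, v == a i, itp n (a i) v, itp n v (a i.+1)).

(** A point inside one block is answered inside another; this move spends the extra rank in the
    hypotheses on rank [n.+1] types. *)
Lemma block_shift i i' v : block i v -> i' < M ->
  exists2 v', block i' v' & key i v = key i' v'.
Proof.
move=> /andP[iM /andP[av va]] iM'; have lt_i : i < i.+1 <= M by lia.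
have lt_i' : i' < i'.+1 <= M by lia.
move: av; rewrite leq_eqVlt => /orP[/eqP Ev|av].
  exists (a i'); first by rewrite /block iM' leqnn a_mono.
  rewrite /key -Ev !eqxx (itp_refl _ _ _ (a i')) (a_col (i := i) (j := i')); try lia.
  by rewrite (itp_pred (a_pair lt_i lt_i')).
have [|v' [lt_v' E1 E2 E3]] := itp_forth (t := v) (a_pair lt_i lt_i').
  by rewrite av.
exists v'; first by rewrite /block iM'; lia.
by rewrite /key E1 E2 E3 [v == _]gtn_eqF 1?[v' == _]gtn_eqF //; lia.
Qed.

Lemma key_left i v i' v' x x' : block i v -> block i' v' -> key i v = key i' v' ->
  x < a i -> x' < a i' -> itp n x (a i) = itp n x' (a i') ->
  itp n x v = itp n x' v'.
Proof.
move=> /andP[iM /andP[av va]] /andP[iM' /andP[av' va']] [_ E0 E1 _] xa xa' Ex.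
case: (eqVneq v (a i)) E0 => [->|nv /esym/eqP nv']; first by move=> /esym/eqP->.
apply: itp_comp Ex _ E1; try lia.
by apply: a_col; lia.
Qed.

Lemma key_right i v i' v' y y' : block i v -> block i' v' -> key i v = key i' v' ->
  a i.+1 < y -> a i'.+1 < y' -> itp n (a i.+1) y = itp n (a i'.+1) y' ->
  itp n v y = itp n v' y'.
Proof.
move=> /andP[iM /andP[av va]] /andP[iM' /andP[av' va']] [_ _ _ E1] ya ya' Ey.
apply: itp_comp E1 _ Ey; try lia.
by apply: a_col; lia.
Qed.

Definition same_unary v v' :=
  [/\ col v = col v', itp n 0 v = itp n 0 v' & itp n v B = itp n v' B].

Lemma key_unary i v i' v' : block i v -> block i' v' -> key i v = key i' v' ->
  same_unary v v'.
Proof.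
move=> bv bv' E; have [iM _] := andP bv; have [iM' _] := andP bv'.
have := @a_bound i; have := @a_bound i'; have := @a_bound i.+1; have := @a_bound i'.+1.
move=> a1 a2 a3 a4; split; first by case: E.
  by apply: key_left bv bv' E _ _ (itp_pred (a_left _ _)); lia.
by apply: key_right bv bv' E _ _ (itp_pred (a_right _ _)); lia.
Qed.

Lemma same_unary_refl v : same_unary v v. Proof. by []. Qed.

Lemma order_bf_unary v v' : 0 < v < B -> 0 < v' < B -> same_unary v v' ->
  order_bf col n [:: (v, v'); (0, 0); (B, B)].
Proof.
move=> vB vB' [E1 E2 E3].
apply: order_bf_cons => //.
  by move=> x y; rewrite !inE => /orP[]/eqP-> /orP[]/eqP->; split.
by move=> y; rewrite !inE => /orP[]/eqP-> /=; [apply: Or32|apply: Or31]; split=> //; lia.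
Qed.

Lemma order_bf_binary u v u' v' : 0 < u -> u < v < B -> 0 < u' -> u' < v' < B ->
  same_unary u u' -> same_unary v v' -> itp n u v = itp n u' v' ->
  order_bf col n [:: (u, u'); (v, v'); (0, 0); (B, B)].
Proof.
move=> u0 vB u0' vB' [E1 E2 E3] Ev Euv.
apply: order_bf_cons => //; first by apply: order_bf_unary => //; lia.
move=> y; rewrite !inE => /predU1P[->|/orP[]/eqP->] /=.
- by apply: Or31; split=> //; lia.
- by apply: Or32; split=> //; lia.
- by apply: Or31; split=> //; lia.
Qed.

(** The number of cut points up to [v]: 0 left of all blocks, [i.+1] in block [i], and [M.+1] from
    [a M] on. *)
Definition loc v := find (fun i => v < a i) (iota 0 M.+1).

Lemma loc_leq v : loc v <= M.+1.
Proof. by rewrite -[M.+1](size_iota 0) find_size. Qed.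

Lemma leq_loc v i : i <= M -> (a i <= v) = (i < loc v).
Proof.
move=> iM; case: ltnP => [lt_i|ge_i].
  have := before_find 0 lt_i; rewrite nth_iota /= ?add0n; last by lia.
  by move/negbT; rewrite -leqNgt.
have lt_M : loc v < M.+1 by lia.
have : has (fun i => v < a i) (iota 0 M.+1) by rewrite has_find size_iota.
move/(nth_find 0); rewrite -/(loc v) nth_iota // add0n => lt_v.
apply/negbTE; rewrite -ltnNge; apply: leq_trans lt_v _.
move: ge_i; rewrite leq_eqVlt => /predU1P[->//|lt].
by apply/ltnW/a_mono; lia.
Qed.

Lemma loc_block v : 0 < loc v <= M -> block (loc v).-1 v.
Proof.
move=> /andP[l0 lM]; rewrite /block (ltn_predK l0) lM.
by rewrite ltnNge !leq_loc ?ltnn ?andbT //; lia.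
Qed.

Lemma block_loc i v : block i v -> loc v = i.+1.
Proof.
move=> /andP[iM /andP[av va]]; apply/eqP; rewrite eqn_leq -leq_loc ?av; last by lia.
by rewrite andbT leqNgt -leq_loc // -ltnNge.
Qed.

Section Graph.
Variables (G : sgraph) (h : G -> 'I_n * nat).
Hypothesis h_bound : forall z, 0 < (h z).2 < B.
Hypothesis h_ex : forall z t, 0 < t < B ->
  order_bf col n [:: ((h z).2, t); (0, 0); (B, B)] -> exists z', h z' = ((h z).1, t).
Hypothesis h_adj : forall y z y' z', (h y).1 = (h y').1 -> (h z).1 = (h z').1 ->
  order_bf col n [:: ((h y).2, (h y').2); ((h z).2, (h z').2); (0, 0); (B, B)] ->
  adj y z = adj y' z'.
Hypothesis nobic : no_biclique n G.

Definition vloc z := loc (h z).2.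
Definition vkey z : 'I_n * key_type := ((h z).1, key (vloc z).-1 (h z).2).

Lemma vloc_block z : 0 < vloc z <= M -> block (vloc z).-1 (h z).2.
Proof. exact: loc_block. Qed.

Lemma vkeyP y z : vkey y = vkey z ->
  (h y).1 = (h z).1 /\ key (vloc y).-1 (h y).2 = key (vloc z).-1 (h z).2.
Proof. by move=> E; split; [move/(congr1 fst): E|move/(congr1 snd): E]. Qed.

Lemma vkey_unary y z : 0 < vloc y <= M -> 0 < vloc z <= M -> vkey y = vkey z ->
  same_unary (h y).2 (h z).2.
Proof.
move=> ly lz /vkeyP[_ E].
exact: key_unary (vloc_block ly) (vloc_block lz) E.
Qed.

(** The twin position given by [block_shift] has the same unary type, so by [h_ex] it carries a
    vertex with the same copy index. *)
Lemma vkey_shift z i : 0 < vloc z <= M -> 0 < i <= M ->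
  exists z', vloc z' = i /\ vkey z' = vkey z.
Proof.
move=> lz iM; have bz := vloc_block lz.
have [|v' bv' Ek] := block_shift (i' := i.-1) bz; first by lia.
have v'B : 0 < v' < B.
  have a1 : 0 < a i.-1 < B by apply: a_bound; lia.
  have a2 : 0 < a i < B by apply: a_bound; lia.
  by case/andP: bv'; rewrite prednK; lia.
have [z' Ez'] := h_ex v'B (order_bf_unary (h_bound z) v'B (key_unary bz bv' Ek)).
have lz' : vloc z' = i by rewrite /vloc Ez' (block_loc bv'); lia.
by exists z'; split=> //; rewrite /vkey lz' Ez' Ek.
Qed.

Lemma card_spread z lo : 0 < vloc z <= M -> 0 < lo -> lo + n <= M.+1 ->
  n <= #|[set z' | (lo <= vloc z' < lo + n) && (vkey z' == vkey z)]|.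
Proof.
move=> lz lo0 loM.
have [|f Hf] := @fin_all_exists 'I_n (fun=> G) (fun i z' => vloc z' = lo + i /\ vkey z' = vkey z).
  by move=> i; apply: vkey_shift => //; have := ltn_ord i; lia.
have finj : injective f.
  move=> i j Ef; apply/val_inj; have [H _] := Hf i; have [] := Hf j.
  by rewrite -Ef H /=; lia.
rewrite -[X in X <= _]card_ord -(card_imset _ finj); apply: subset_leq_card.
apply/subsetP => _ /imsetP[i _ ->]; rewrite inE; have [-> ->] := Hf i.
by rewrite eqxx andbT; have := ltn_ord i; lia.
Qed.

(** With a whole block in between, the interval from [y] to [z] is composed of data in the two keys
    and of an interval between cut points, whose type is constant by [a_pair]. *)
Lemma adj_key_key y z y' z' : 0 < vloc y -> vloc y + 2 <= vloc z <= M ->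
  0 < vloc y' -> vloc y' + 2 <= vloc z' <= M ->
  vkey y = vkey y' -> vkey z = vkey z' -> adj y z = adj y' z'.
Proof.
move=> y0 zM y0' zM' Ey Ez; have [[cy ky] [cz kz]] := (vkeyP Ey, vkeyP Ez).
have ly : 0 < vloc y <= M by lia.
have ly' : 0 < vloc y' <= M by lia.
have lz : 0 < vloc z <= M by lia.
have lz' : 0 < vloc z' <= M by lia.
have [by_ bz] := (vloc_block ly, vloc_block lz).
have [by' bz'] := (vloc_block ly', vloc_block lz').
have a1 : a (vloc y) < a (vloc z).-1 by apply: a_mono; lia.
have a2 : a (vloc y') < a (vloc z').-1 by apply: a_mono; lia.
apply: h_adj => //; apply: order_bf_binary.
- by have := h_bound y; lia.
- have := h_bound z; move: by_ bz; rewrite /block.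
  by rewrite (ltn_predK y0); lia.
- by have := h_bound y'; lia.
- have := h_bound z'; move: by' bz'; rewrite /block.
  by rewrite (ltn_predK y0'); lia.
- exact: vkey_unary.
- exact: vkey_unary.
apply: (key_right by_ by' ky).
- by move: bz; rewrite (ltn_predK y0) /block; lia.
- by move: bz'; rewrite (ltn_predK y0') /block; lia.
rewrite (ltn_predK y0) (ltn_predK y0').
apply: (key_left bz bz' kz).
- exact: a1.
- exact: a2.
by apply/itp_pred/a_pair; lia.
Qed.

Lemma adj_left_key y z z' : vloc y = 0 -> 2 <= vloc z <= M -> 2 <= vloc z' <= M ->
  vkey z = vkey z' -> adj y z = adj y z'.
Proof.
move=> ly zM zM' Ez; have [cz kz] := vkeyP Ez.
have lz : 0 < vloc z <= M by lia.
have lz' : 0 < vloc z' <= M by lia.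
have [bz bz'] := (vloc_block lz, vloc_block lz').
have ya : (h y).2 < a 0 by rewrite ltnNge leq_loc // -/(vloc y) ly.
have a1 : a 0 < a (vloc z).-1 by apply: a_mono; lia.
have a2 : a 0 < a (vloc z').-1 by apply: a_mono; lia.
apply: h_adj => //; apply: order_bf_binary.
- by have := h_bound y; lia.
- by have := h_bound z; move: bz; rewrite /block; lia.
- by have := h_bound y; lia.
- by have := h_bound z'; move: bz'; rewrite /block; lia.
- exact: same_unary_refl.
- exact: vkey_unary.
apply: (key_left bz bz' kz).
- by lia.
- by lia.
apply: (itp_comp (y := a 0) (y' := a 0)) => //; try lia.
by apply/itp_pred/a_pair; lia.
Qed.

Lemma adj_right_key y z z' : vloc y = M.+1 -> 0 < vloc z < M -> 0 < vloc z' < M ->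
  vkey z = vkey z' -> adj z y = adj z' y.
Proof.
move=> ly zM zM' Ez; have [cz kz] := vkeyP Ez.
have lz : 0 < vloc z <= M by lia.
have lz' : 0 < vloc z' <= M by lia.
have [bz bz'] := (vloc_block lz, vloc_block lz').
have ya : a M <= (h y).2 by rewrite leq_loc // -/(vloc y) ly.
have a1 : a (vloc z) < a M by apply: a_mono; lia.
have a2 : a (vloc z') < a M by apply: a_mono; lia.
have z0 : 0 < vloc z by lia.
have z0' : 0 < vloc z' by lia.
apply: h_adj => //; apply: order_bf_binary.
- by have := h_bound z; lia.
- by have := h_bound y; move: bz; rewrite /block (ltn_predK z0); lia.
- by have := h_bound z'; lia.
- by have := h_bound y; move: bz'; rewrite /block (ltn_predK z0'); lia.
- exact: vkey_unary.
- exact: same_unary_refl.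
apply: (key_right bz bz' kz).
- by rewrite (ltn_predK z0); lia.
- by rewrite (ltn_predK z0'); lia.
rewrite (ltn_predK z0) (ltn_predK z0').
have Ez1 : itp n (a (vloc z)) (a M) = itp n (a (vloc z')) (a M).
  by apply/itp_pred/a_pair; lia.
move: ya; rewrite leq_eqVlt => /predU1P[<-//|ya].
by apply: (itp_comp (y := a M) (y' := a M)) => //; lia.
Qed.

(** Such an edge would be repeated between all twins of [y] in the first [n] blocks and all twins of
    [z] in [n] blocks after a gap of one, which accounts for [n.*2.+1]. *)
Lemma adj_middle y z : n.*2.+1 <= M -> 0 < vloc y -> vloc y + 2 <= vloc z <= M ->
  ~~ adj y z.
Proof.
move=> nM y0 zM; apply/negP => yz.
have [||y' [z' [+ + /negP[]]]] := nobic
  (Y := [set y' | (1 <= vloc y' < 1 + n) && (vkey y' == vkey y)])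
  (Z := [set z' | (n.+2 <= vloc z' < n.+2 + n) && (vkey z' == vkey z)]).
- by apply: card_spread; lia.
- by apply: card_spread; lia.
rewrite !inE => /andP[ly' /eqP ky'] /andP[lz' /eqP kz'].
by rewrite (@adj_key_key _ _ y z) //; lia.
Qed.

(** Neighbours in the first block do not count, because [adj_left_key] only applies from the second
    block on. *)
Definition outer_left :=
  [set y | (vloc y == 0) && [exists z, adj y z && (1 < vloc z <= M)]].

Definition outer_right :=
  [set y | (vloc y == M.+1) && [exists z, adj y z && (0 < vloc z < M)]].

(** Each such vertex picks the key of one of its neighbours in the blocks. More than [n] vertices
    with the same choice would be adjacent to all twins of that neighbour in [n] blocks, a biclique.
    The default value of [odflt] never occurs on this set. *)
Lemma card_outer_left : n < M -> #|outer_left| <= #|{: 'I_n * key_type}| * n.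
Proof.
move=> nM; rewrite leqNgt; apply/negP.
pose P y z := adj y z && (1 < vloc z <= M).
move/(pigeonhole (fun y => vkey (odflt y [pick z | P y z]))) => [kap].
set Y := [set y in _ | _] => cY.
have HY y : y \in Y -> vloc y = 0 /\ exists z, P y z /\ vkey z = kap.
  rewrite !inE => /andP[/andP[/eqP ly /existsP[z Pz]]].
  case: pickP => [z' Pz' /eqP kz|/(_ z)]; last by rewrite /P Pz.
  by split=> //; exists z'.
have [y0 /HY[_ [z0 [/andP[_ lz0] kz0]]]] : exists y, y \in Y by apply/card_gt0P; lia.
have [||y [z [/HY[ly [z1 [/andP[yz1 lz1] kz1]]] + /negP[]]]] := nobic (Y := Y)
  (Z := [set z' | (2 <= vloc z' < 2 + n) && (vkey z' == vkey z0)]).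
- exact: ltnW.
- by apply: card_spread; lia.
rewrite inE => /andP[lz /eqP kz].
by rewrite (adj_left_key (z' := z1)) //; [lia|rewrite kz kz0 kz1].
Qed.

Lemma card_outer_right : n < M -> #|outer_right| <= #|{: 'I_n * key_type}| * n.
Proof.
move=> nM; rewrite leqNgt; apply/negP.
pose P y z := adj y z && (0 < vloc z < M).
move/(pigeonhole (fun y => vkey (odflt y [pick z | P y z]))) => [kap].
set Y := [set y in _ | _] => cY.
have HY y : y \in Y -> vloc y = M.+1 /\ exists z, P y z /\ vkey z = kap.
  rewrite !inE => /andP[/andP[/eqP ly /existsP[z Pz]]].
  case: pickP => [z' Pz' /eqP kz|/(_ z)]; last by rewrite /P Pz.
  by split=> //; exists z'.
have [y0 /HY[_ [z0 [/andP[_ lz0] kz0]]]] : exists y, y \in Y by apply/card_gt0P; lia.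
have [||y [z [/HY[ly [z1 [/andP[yz1 lz1] kz1]]] + /negP[]]]] := nobic (Y := Y)
  (Z := [set z' | (1 <= vloc z' < 1 + n) && (vkey z' == vkey z0)]).
- exact: ltnW.
- by apply: card_spread; lia.
rewrite inE => /andP[lz /eqP kz].
rewrite adj_sym (adj_right_key (z' := z1)) 1?adj_sym //; first by lia.
by rewrite kz kz0 kz1.
Qed.

Definition outer := outer_left :|: outer_right.

(** A walk that starts deep enough among the blocks changes block by at most one per edge: longer
    jumps contradict [adj_middle], and escapes from the blocks would go through deleted vertices. *)
Lemma near_middle r x y : n.*2.+1 <= M -> r.+1 < vloc x -> vloc x + r < M ->
  near (del (@adj G) outer) r y x ->
  vloc x - r <= vloc y <= vloc x + r.
Proof.
move=> nM lx lM /(@near_inv _ _ (fun d y => d <= r -> vloc x - d <= vloc y <= vloc x + d)).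
apply=> //.
- by move=> _; lia.
- by move=> d z IH dr; have := IH (ltnW dr); lia.
move=> d u v /and3P[uv nu nv] IH dr; have {IH} := IH (ltnW dr) => lv.
move: nu; rewrite !inE negb_or => /andP[nl nr].
have l0 : vloc u != 0.
  apply: contra nl => ->; apply/existsP; exists v; rewrite uv; lia.
have lM1 : vloc u != M.+1.
  apply: contra nr => ->; apply/existsP; exists v; rewrite uv; lia.
have lu : vloc u <= M.+1 by apply: loc_leq.
have c1 : ~~ (vloc u + 2 <= vloc v).
  by apply: contraL uv => H; apply: adj_middle; lia.
have c2 : ~~ (vloc v + 2 <= vloc u).
  by apply: contraL uv => H; rewrite adj_sym; apply: adj_middle; lia.
by lia.
Qed.

End Graph.
End Blocks.

(** A large set is thinned to vertices of equal copy index and unary type, then by Ramsey's theorem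
    to positions with homogeneous intervals, which serve as cut points. Every [r.+1]-st of them is
    kept and the outer vertices are deleted. *)
Theorem word_graph_quasi_wide n : exists g, forall r m, exists N,
  forall G, word_graph n G -> quasi_wide (@adj G) r g m N.
Proof.
pose g := #|{: 'I_n * key_type n}| * n; exists g.*2 => r m.
(* Room for [m] cut points spaced by [r.+1], for margins beyond [r] on both sides, and for the
   [n.*2.+1] blocks used by [adj_middle]. *)
pose M := (r.+1 * m.+2 + n.*2 + r + 5).
have [N HN] := ramsey_pairs (interval_type 'I_n n.+1) M.+1.
pose T : finType := ('I_n * 'I_n * interval_type 'I_n n.+1 * interval_type 'I_n n.+1)%type.
exists (#|T| * N).+1 => G [B [col [h [hinj hB hex hadj nobic]]]] A cA.
pose pos z := (h z).2.
have [[[[c k] tl] tr]] := @pigeonhole T _ (fun z => ((h z).1, col (pos z),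
  itp col n.+1 0 (pos z), itp col n.+1 (pos z) B)) A N cA.
set A0 := [set z in A | _] => cA0.
have HA0 z : z \in A0 -> [/\ z \in A, (h z).1 = c, col (pos z) = k,
    itp col n.+1 0 (pos z) = tl & itp col n.+1 (pos z) B = tr].
  by rewrite inE => /andP[zA /eqP[? ? ? ?]].
have posinj : {in A0 &, injective pos}.
  move=> x y /HA0[_ cx _ _ _] /HA0[_ cy _ _ _] E; apply: hinj.
  by rewrite (surjective_pairing (h x)) (surjective_pairing (h y)) cx cy -/(pos x) E.
pose s := sort (relpre pos leq) (enum A0).
have [|s' [t [sub sz pw]]] := HN _ (fun y z => itp col n.+1 (pos y) (pos z)) s.
  by rewrite size_sort -cardE ltnW.
have sA0 z : z \in s' -> z \in A0.
  by move/(mem_subseq sub); rewrite mem_sort mem_enum.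
have z0 : G by case: (s') sz => [|z].
pose x i := nth z0 s' i; pose a i := pos (x i).
have xs i : i <= M -> x i \in s' by move=> iM; rewrite mem_nth // sz.
have xA0 i : i <= M -> x i \in A0 by move=> iM; apply/sA0/xs.
have sorted_pos : sorted ltn (map pos s').
  rewrite ltn_sorted_uniq_leq; apply/andP; split.
    rewrite map_inj_in_uniq; first by apply: subseq_uniq sub _; rewrite sort_uniq enum_uniq.
    by move=> y z /sA0 yA /sA0 zA; apply: posinj.
  rewrite sorted_map; apply: subseq_sorted sub _; first by move=> ? ? ?; apply: leq_trans.
  by apply: sort_sorted => y z; apply: leq_total.
have a_mono i j : i < j <= M -> a i < a j.
  move=> /andP[ij jM]; have := sorted_ltn_nth ltn_trans 0 sorted_pos.
  move=> /(_ i j); rewrite !inE size_map sz.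
  by rewrite !(nth_map z0) ?sz; [apply=> //|..]; lia.
have a_bound i : i <= M -> 0 < a i < B by move=> _; apply: hB.
have a_col i j : i <= M -> j <= M -> col (a i) = col (a j).
  by move=> /xA0/HA0[_ _ + _ _] /xA0/HA0[_ _ + _ _]; rewrite /a => -> ->.
have a_left i j : i <= M -> j <= M -> itp col n.+1 0 (a i) = itp col n.+1 0 (a j).
  by move=> /xA0/HA0[_ _ _ + _] /xA0/HA0[_ _ _ + _]; rewrite /a => -> ->.
have a_right i j : i <= M -> j <= M -> itp col n.+1 (a i) B = itp col n.+1 (a j) B.
  by move=> /xA0/HA0[_ _ _ _ +] /xA0/HA0[_ _ _ _ +]; rewrite /a => -> ->.
have a_pair1 i j : i < j <= M -> itp col n.+1 (a i) (a j) = t.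
  move=> /andP[ij jM]; have := pairwiseP z0 pw i j.
  by rewrite !inE sz => /(_ _ _ _)/eqP; apply; lia.
have a_pair i j i' j' : i < j <= M -> i' < j' <= M ->
    itp col n.+1 (a i) (a j) = itp col n.+1 (a i') (a j').
  by move=> ij ij'; rewrite !a_pair1.
pose vl := vloc M a h.
have vlx i : i < M -> vl (x i) = i.+1.
  move=> iM; rewrite /vl /vloc; apply: (block_loc a_mono).
  by rewrite /block iM leqnn /=; apply: a_mono; lia.
pose idx (j : 'I_m) := r.+1 * j.+1.
have idxM j : r.+1 <= idx j /\ idx j + r + 2 < M.
  by have := ltn_ord j; rewrite /idx /M; nia.
exists (outer M a h), [set x (idx j) | j : 'I_m]; split.
- apply: leq_trans (leq_card_setU _ _) _; rewrite -addnn leq_add //.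
    by apply: (card_outer_left a_mono a_bound a_col a_left a_right a_pair hB hex hadj
      nobic); rewrite /M; lia.
  by apply: (card_outer_right a_mono a_bound a_col a_left a_right a_pair hB hex hadj
    nobic); rewrite /M; lia.
- apply/subsetP => _ /imsetP[j _ ->]; have [_ lj] := idxM j.
  by have [|] := HA0 (x (idx j)) => //; apply: xA0; lia.
- rewrite card_imset ?card_ord // => i j E; apply/val_inj.
  have [_ li] := idxM i; have [_ lj] := idxM j.
  have Hi : vl (x (idx i)) = (idx i).+1 by apply: vlx; lia.
  have Hj : vl (x (idx j)) = (idx j).+1 by apply: vlx; lia.
  by move: Hj; rewrite -E Hi => /eqP; rewrite eqSS eqn_pmul2l // => /eqP[].
- apply/pred0P => y /=; apply/negbTE/negP => /andP[/imsetP[j _ ->]].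
  have [l1 l2] := idxM j; rewrite !inE -/(vl _) vlx; last by lia.
  by case/orP=> /andP[/eqP]; lia.
move=> _ _ /imsetP[i _ ->] /imsetP[j _ ->] ij.
have [li1 li2] := idxM i; have [lj1 lj2] := idxM j.
have Hi : vl (x (idx i)) = (idx i).+1 by apply: vlx; lia.
have Hj : vl (x (idx j)) = (idx j).+1 by apply: vlx; lia.
have nij : val i != val j by apply: contra ij => /eqP/val_inj->.
apply/negP => nr.
have := near_middle a_mono a_bound a_col a_left a_right a_pair hB hex hadj nobic
  _ _ _ nr.
rewrite -/vl Hi Hj => H.
have M1 : n.*2.+1 <= M by rewrite /M; lia.
have {H} := H M1 _ _.
have : idx i + r.+1 <= idx j \/ idx j + r.+1 <= idx i.
  by rewrite /idx -!mulnSr !leq_pmul2l // !ltnS; move: nij; rewrite neq_ltn => /orP[]; [left|right].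
by case=> le_ij /(_ _ _); lia.
Qed.

(** * Subdivisions *)

Lemma quasi_wide_leq (G : finType) (R : rel G) r g g' m N N' :
  g <= g' -> N <= N' -> quasi_wide R r g m N -> quasi_wide R r g' m N'.
Proof.
move=> gg NN qw A cA; have [|S [A' [H1 H2 H3 H4 H5]]] := qw A.
  exact: leq_trans cA.
by exists S, A'; split=> //; apply: leq_trans gg.
Qed.

Lemma word_graph_quasi_wide_bounded b : exists g, forall r m, exists N,
  forall n G, n <= b -> word_graph n G -> quasi_wide (@adj G) r g m N.
Proof.
have [] : exists g, forall r m, exists N,
    forall n G, n < b.+1 -> word_graph n G -> quasi_wide (@adj G) r g m N.
  elim: b.+1 => [|c [g Hg]]; first by exists 0 => r m; exists 0.
  have [g' Hg'] := word_graph_quasi_wide c.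
  exists (maxn g g') => r m; have [[N HN] [N' HN']] := (Hg r m, Hg' r m).
  exists (maxn N N') => n G; rewrite ltnS leq_eqVlt => /predU1P[->|nc] wg.
    by apply: quasi_wide_leq (HN' _ wg); apply: leq_maxr.
  by apply: quasi_wide_leq (HN _ _ nc wg); apply: leq_maxl.
by move=> g Hg; exists g.
Qed.

Section Subdivision.
Variables (n : nat) (G : sgraph).
Implicit Types (u v w : G).

(* [(u, None)] is the vertex [u] of [G]; the [(u, Some (v, l))] with [l < n] form
   a path hanging at [u], whose end is joined to the end of the opposite path
   [(v, Some (u, _))] when [u] and [v] are adjacent. *)
Definition subdiv_adj : rel (G * option (G * 'I_n)) := fun x y =>
  match x.2, y.2 with
  | None, Some (v, l) | Some (v, l), None => (x.1 == y.1) && (l == 0 :> nat)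
  | Some (v, l), Some (v', l') =>
      [&& x.1 == y.1, v == v' & (l.+1 == l') || (l'.+1 == l)] ||
      [&& x.1 == v', v == y.1, l.+1 == n, l'.+1 == n & adj x.1 v]
  | None, None => false
  end.

Lemma subdiv_adj_sym : symmetric subdiv_adj.
Proof.
move=> [u [[v l]|]] [w [[v' l']|]]; rewrite /subdiv_adj /= // 1?[u == w]eq_sym //.
rewrite [v == v']eq_sym [(l.+1 == l') || _]orbC; congr (_ || _).
case: (eqVneq w v) => [<-|] /=; last by rewrite !andbF.
case: (eqVneq v' u) => [->|] //=.
by rewrite adj_sym andbCA.
Qed.

Lemma subdiv_adj_irr : irreflexive subdiv_adj.
Proof.
move=> [u [[v l]|]] //; rewrite /subdiv_adj /=; apply/negbTE; rewrite negb_or.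
apply/andP; split; apply/negP; first by move=> /and3P[_ _ /orP[]/eqP]; lia.
by move=> /and5P[/eqP-> _ _ _]; rewrite adj_irr.
Qed.

Definition subdiv := SGraph subdiv_adj_sym subdiv_adj_irr.
Implicit Types (x y z : subdiv).

Definition owner x : G := x.1.
Definition target x : option G := omap fst x.2.
Definition level x : nat := if x.2 is Some (_, l) then nat_of_ord l else 0.

Lemma target_level_inj x y :
  owner x = owner y -> target x = target y -> level x = level y -> x = y.
Proof.
case: x => u [[v l]|]; case: y => w [[v' l']|] //= -> //.
by move=> [->] /val_inj->.
Qed.

Lemma level_lt x v : target x = Some v -> level x < n.
Proof. by case: x => u [[w l]|] // _; apply: ltn_ord. Qed.

Lemma subdiv_adjP y z : adj y z ->
  [\/ [/\ owner y = owner z, target y = target z &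
          (level y).+1 = level z \/ (level z).+1 = level y],
      owner y = owner z /\ (target y = None \/ target z = None) /\
          (level y = 0 /\ level z = 0) |
      [/\ target z = Some (owner y), target y = Some (owner z),
          (level y).+1 = n, (level z).+1 = n & adj (owner y) (owner z)]].
Proof.
case: y => u [[v l]|]; case: z => w [[v' l']|]; rewrite /= /subdiv_adj /=.
- move=> /orP[/and3P[/eqP-> /eqP-> ll]|/and5P[/eqP-> /eqP-> /eqP ln /eqP ln' a]].
    by apply: Or31; split=> //; case/orP: ll => /eqP; [left|right].
  by apply: Or33.
- by move=> /andP[/eqP-> /eqP l0]; apply: Or32; split=> //; split; [right|].
- by move=> /andP[/eqP-> /eqP l0]; apply: Or32; split=> //; split; [left|].
by [].
Qed.

(** Once the middle of an edge is crossed, [n] further edges lead to the next hub, so a walk with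
    [r < n] stays on the opposite path; [n <= d + level y] expresses this. *)
Lemma near_far_owner r x y : r < n -> near (@adj subdiv) r y x ->
  owner y = owner x \/ target y = Some (owner x).
Proof.
move=> rn /(@near_inv _ _ (fun d y => d <= r -> owner y = owner x \/
  (target y = Some (owner x) /\ n <= d + level y))) H.
have [|||H1|[H1 _]] := H _ _ _ (leqnn _); [by left| | |by left|by right].
  move=> d z IH dr; have [|H1|[H1 H2]] := IH; [by lia|by left|].
  by right; split=> //; lia.
move=> d z1 z2 zz IH dr; have {IH}[|H1|[H1 H2]] := IH; first by lia.
  have [[-> _ _]|[-> _]|[H2 H3 H4 H5 H6]] := subdiv_adjP zz; [by left|by left|].
  by right; rewrite H3 H1; split=> //; lia.
have [[E1 E2 E3]|[E1 [E2 [E3 E4]]]|[E1 E2 E3 E4 E5]] := subdiv_adjP zz.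
- by right; rewrite E2; split=> //; lia.
- by move: H2; rewrite E4; lia.
by left; move: H1; rewrite E1 => -[].
Qed.

(** With the hub of [u] deleted, the only way off a path at [u] leads through the opposite path to
    another hub, which is too far. *)
Lemma near_far_target r u v (S : {set subdiv}) x y : r < n -> (u, None) \in S ->
  owner x = u -> target x = Some v -> near (del (@adj subdiv) S) r y x ->
  owner y = u -> target y = Some v.
Proof.
move=> rn uS ox tx /(@near_inv _ _ (fun d y => d <= r ->
  (owner y = u /\ target y = Some v) \/
  [/\ owner y = v, target y = Some u & n <= d + level y])) H.
have [|||[_ ->]//|[-> -> _ ->//]] := H _ _ _ (leqnn _); first by left.
  move=> d z IH dr; have [|[H1 H1']|[H1 H2 H3]] := IH; [by lia|by left|].
  by right; split=> //; lia.
move=> d z1 z2 /and3P[zz z1S z2S] IH dr; have {IH}[|[H1 H2]|[H1 H2 H3]] := IH; first by lia.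
  have [[-> -> _]|[E1 [[E2|E2] _]]|[E1 E2 E3 E4 E5]] := subdiv_adjP zz.
  - by left.
  - case/negP: z1S; suff -> : z1 = (u, None) by [].
    by apply: target_level_inj; rewrite ?E1 ?H1 ?E2 //; move: E2; case: (z1) => ? [[]|].
  - by rewrite E2 in H2.
  right; rewrite E2 H1; split=> //; last by lia.
  by move: H2; rewrite E1 => -[].
have [[E1 E2 E3]|[E1 [E2 [E3 E4]]]|[E1 E2 E3 E4 E5]] := subdiv_adjP zz.
- by right; rewrite E1 E2; split=> //; lia.
- by move: H3; rewrite E4; lia.
by left; rewrite E2 H1; split=> //; move: H2; rewrite E1 => -[].
Qed.

(** With both hubs deleted the subdivided edge is cut off from the rest, and walks just move along
    it. The second disjunct of the invariant describes the half owned by [v]. *)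
Lemma near_path r u v (S : {set subdiv}) x y : (u, None) \in S -> (v, None) \in S ->
  owner x = u -> target x = Some v -> owner y = u -> target y = Some v ->
  near (del (@adj subdiv) S) r y x -> level x <= level y + r.
Proof.
move=> uS vS ox tx oy ty; have lx := level_lt tx.
move=> /(@near_inv _ _ (fun d y =>
  [/\ owner y = u, target y = Some v, level x <= level y + d & level y <= level x + d] \/
  [/\ adj u v, owner y = v, target y = Some u & n + n <= level x + level y + d + 1])) H.
have [|||[]//|[uv oy']] := H; first by left; split=> //; lia.
- move=> d z [[H1 H2 H3 H4]|[H1 H2 H3 H4]]; [left|right]; split=> //; lia.
- move=> d z1 z2 /and3P[zz z1S z2S] [[H1 H2 H3 H4]|[H1 H2 H3 H4]].
    have [[-> -> E]|[E1 [[E2|E2] _]]|[E1 E2 E3 E4 E5]] := subdiv_adjP zz.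
    + by left; split=> //; lia.
    + case/negP: z1S; suff -> : z1 = (u, None) by [].
      by apply: target_level_inj; rewrite ?E1 ?H1 ?E2 //; move: E2; case: (z1) => ? [[]|].
    + by rewrite E2 in H2.
    have Ez1 : owner z1 = v by move: H2; rewrite E1 => -[].
    right; rewrite E2 H1 Ez1; split=> //; last by lia.
    by rewrite adj_sym -Ez1 -H1.
  have [[-> -> E]|[E1 [[E2|E2] _]]|[E1 E2 E3 E4 E5]] := subdiv_adjP zz.
  + by right; split=> //; have := level_lt H3; lia.
  + case/negP: z1S; suff -> : z1 = (v, None) by [].
    by apply: target_level_inj; rewrite ?E1 ?H2 ?E2 //; move: E2; case: (z1) => ? [[]|].
  + by rewrite E2 in H3.
  have Ez1 : owner z1 = u by move: H3; rewrite E1 => -[].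
  by left; rewrite Ez1 E2 H2; split=> //; lia.
by move: uv; rewrite -oy' oy adj_irr.
Qed.

Definition hubs (S : {set G}) : {set subdiv} := [set (u, None) | u in S].

(* Maps a path hanging at a deleted vertex to the other end of its edge. *)
Definition project (S : {set G}) x : G :=
  if owner x \in S then odflt (owner x) (target x) else owner x.

(** An edge of the subdivision projects to a single vertex, except that the middle of a path between
    two vertices outside [S] projects to an edge of [G]. *)
Lemma near_project (S : {set G}) r x y : project S x \notin S ->
  near (del (@adj subdiv) (hubs S)) r y x ->
  near (del (@adj G) S) r (project S y) (project S x).
Proof.
move=> xS /(@near_inv _ _ (fun d y => project S y \notin S /\
  near (del (@adj G) S) d (project S y) (project S x))) H.
have [|||_ //] := H; first by rewrite near_refl.
  by move=> d z [zS nz]; split=> //; apply: near_leq nz.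
have hubS z : z \notin hubs S -> target z = None -> owner z \notin S.
  move=> + tz; apply: contra => oS; apply/imsetP; exists (owner z) => //.
  by apply: target_level_inj => //; move: tz {oS}; case: z => ? [[]|].
move=> d z1 z2 /and3P[zz z1S z2S] [zS nz].
suff [E|R] : project S z1 = project S z2 \/ del (@adj G) S (project S z1) (project S z2).
- by rewrite E; split=> //; apply: near_leq nz.
- by split; [case/and3P: R|apply: near_step R nz].
have [[E1 E2 _]|[E1 [[E2|E2] _]]|[E1 E2 E3 E4 E5]] := subdiv_adjP zz.
- by left; rewrite /project E1 E2.
- by left; rewrite /project -E1 (negbTE (hubS _ z1S E2)).
- by left; rewrite /project E1 (negbTE (hubS _ z2S E2)).
move: zS; rewrite /project /del E1 E2 /=.
case: (boolP (owner z1 \in S)) => o1; case: (boolP (owner z2 \in S)) => o2 //=.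
- by rewrite o1.
- by left.
- by left.
by right; rewrite E5 o1 o2.
Qed.

End Subdivision.

(** * Quasi-wideness of subdivisions *)

Lemma transversal_or_fiber (I T : finType) (f : I -> T) (A : {set I}) m1 m2 :
  m1 * m2 < #|A| ->
  (exists A' : {set I}, [/\ A' \subset A, m1 < #|A'| & {in A' &, injective f}]) \/
  exists t, m2 < #|[set i in A | f i == t]|.
Proof.
move=> cA; case: (boolP [exists t, m2 < #|[set i in A | f i == t]|]) => [/existsP|/existsPn nt].
  by right.
left; have [a0 a0A] : exists a, a \in A by apply/card_gt0P; lia.
pose g t := odflt a0 [pick i | (i \in A) && (f i == t)].
have gP i : i \in A -> g (f i) \in A /\ f (g (f i)) = f i.
  rewrite /g => iA; case: pickP => [j /andP[jA /eqP]|/(_ i)] //=.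
  by rewrite iA eqxx.
have fgI : {in f @: A, cancel g f}.
  by move=> _ /imsetP[i iA ->]; case: (gP i iA).
exists (g @: (f @: A)); split.
- by apply/subsetP => _ /imsetP[_ /imsetP[i iA ->] ->]; case: (gP i iA).
- rewrite (card_in_imset (can_in_inj fgI)) ltnNge; apply/negP => le1.
  have : #|A| <= #|f @: A| * m2; last by nia.
  rewrite -sum1_card (partition_big f (mem (f @: A))) /=; last by move=> i; apply: imset_f.
  rewrite -sum_nat_const leq_sum // => t _.
  have := nt t; rewrite -leqNgt; apply: leq_trans.
  by rewrite sum1dep_card; apply: eq_leq; apply: eq_card => i; rewrite !inE.
by move=> _ _ /imsetP[s sA ->] /imsetP[t tA ->]; rewrite !fgI // => ->.
Qed.

Lemma card_in_leq (I T : finType) (f : I -> T) (A : {set I}) (B : {set T}) :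
  {in A &, injective f} -> {in A, forall i, f i \in B} -> #|A| <= #|B|.
Proof.
move=> finj fB; rewrite -(card_in_imset finj); apply: subset_leq_card.
by apply/subsetP => _ /imsetP[i iA ->]; apply: fB.
Qed.

(** For [r < n] walks of length [r] are too short to depend on [G]; for [n <= r] only finitely many
    parameters occur, and walks are projected to [G]. *)
Theorem subdiv_quasi_wide r : exists g, forall m, exists N, forall n G,
  word_graph n G -> quasi_wide (@adj (subdiv n G)) r g m N.
Proof.
have [g Hg] := word_graph_quasi_wide_bounded r; exists g.+2 => m.
have [N0 HN0] := Hg r m.
(* [m * 3] serves a greedy choice with two conflicts per vertex and [N0] the quasi-wideness of [G];
   the 2 pays for discarding the hub and the path from [u] to itself; [N3] leaves more than [m]
   levels in one class modulo [r.+1]. *)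
pose N1 := maxn (m * 3) N0; pose N2 := N1 + 2; pose N3 := r.+1 * m + 1.
exists (N1 * (N2 * N3)).+1 => n G wg A cA.
(* Many vertices on distinct stars, or on distinct paths of one star, or on one path. *)
have [[A1 [A1A cA1 inj1]]|[u]] := @transversal_or_fiber _ _ (@owner n G) A _ _ cA.
  case: (ltnP r n) => [rn|nr].
    have [|||A2 A21 [cA2 ind]] := @greedy_independent _ (near (@adj (subdiv n G)) r) 2 m A1.
    - exact/near_sym/adj_sym.
    (* Vertices near [x] are owned by [owner x] or by its target, and [A1] has at most one vertex
       per owner. *)
    - move=> x xA1; apply: (@leq_trans #|[set Some (owner x); target x]|); last first.
        by rewrite cards2; case: (_ != _).
      apply: (@card_in_leq _ _ (fun y => Some (owner y))).
        by move=> y z; rewrite !inE => /andP[yA _] /andP[zA _] [/inj1]; apply.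
      move=> y; rewrite !inE => /andP[yA nxy].
      have [->|->] := near_far_owner rn nxy; by rewrite eqxx ?orbT.
    - by rewrite (leq_trans _ (ltnW cA1)) // leq_maxl.
    exists set0, A2; split=> //; first by rewrite cards0.
      exact: subset_trans A1A.
      by rewrite disjoints_subset setC0 subsetT.
    move=> x y xA yA xy; apply: contra (ind x y xA yA xy).
    by apply: near_sub => ? ? /and3P[].
  have [|S [A2 [cS A21 cA2 nS sc]]] := quasi_wide_family (HN0 n G nr wg) inj1.
    by rewrite (leq_trans _ (ltnW cA1)) // leq_maxr.
  exists (hubs n S), A2; split=> //.
  - by rewrite (leq_trans (leq_imset_card _ _)) // (leq_trans cS) // leqW.
  - exact: subset_trans A1A.
  - apply/pred0P => x /=; apply/negbTE/negP => /andP[/nS xS /imsetP[w wS xw]].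
    by move: xS; rewrite xw /owner /= wS.
  have pS x : x \in A2 -> project S x = owner x.
    by move/nS/negbTE => nx; rewrite /project nx.
  move=> x y xA yA xy; apply: contra (sc x y xA yA xy) => nxy.
  by rewrite -!pS //; apply: near_project => //; rewrite pS // nS.
set Au := [set i in A | _] => cAu.
have AuA : Au \subset A by apply/subsetP => x; rewrite inE => /andP[].
have Auo x : x \in Au -> owner x = u by rewrite inE => /andP[_ /eqP].
have [[A1 [A1Au cA1 inj1]]|[t]] := @transversal_or_fiber _ _ (@target n G) Au _ _ cAu.
  have A1A : A1 \subset A by apply: subset_trans AuA.
  have A1o x : x \in A1 -> owner x = u by move/(subsetP A1Au)/Auo.
  pose J := [set x in A1 | odflt u (target x) != u].
  have JA1 : J \subset A1 by apply/subsetP => x; rewrite inE => /andP[].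
  have Jt x : x \in J -> exists2 v, target x = Some v & v != u.
    by rewrite inE => /andP[_]; case: (target x) => [v|] /=; [exists v|rewrite eqxx].
  have cJ : N1 <= #|J|.
    have c2 : #|A1 :\: J| <= 2.
      apply: leq_trans (card_in_leq (B := [set None; Some u]) (f := @target n G) _ _) _.
      - by move=> x y /setDP[xA _] /setDP[yA _]; apply: inj1.
      - move=> x; rewrite !inE => /andP[+ xA]; rewrite xA /= negbK.
        by case: (target x) => [v|] //= /eqP->; rewrite eqxx orbT.
      by rewrite cards2.
    by have := cardsID J A1; rewrite (setIidPr JA1) /N2 in cA1 *; lia.
  case: (ltnP r n) => [rn|nr].
    exists [set (u, None)], J; split=> //.
    - by rewrite cards1.
    - exact: subset_trans A1A.
    - by rewrite (leq_trans _ cJ) // (leq_trans _ (leq_maxl _ _)) // leq_pmulr.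
    - apply/pred0P => x /=; apply/negbTE/negP => /andP[/Jt[v tx _]].
      by rewrite inE => /eqP xu; rewrite xu in tx.
    move=> y x yJ xJ; apply: contraNN => nyx; have [v tx _] := Jt _ xJ.
    have [yA xA] := (subsetP JA1 _ yJ, subsetP JA1 _ xJ).
    have ty := near_far_target rn (set11 _) (A1o _ xA) tx nyx (A1o _ yA).
    by apply/eqP/inj1 => //; rewrite ty.
  pose f (x : subdiv n G) := odflt u (target x).
  have fJ : {in J &, injective f}.
    move=> x y xJ yJ; have [[v tx _] [w ty _]] := (Jt _ xJ, Jt _ yJ).
    rewrite /f tx ty /= => E; apply: inj1; rewrite ?(subsetP JA1) //.
    by rewrite tx ty E.
  have [|S [A2 [cS A2J cA2 nS sc]]] := quasi_wide_family (HN0 n G nr wg) fJ.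
    by rewrite (leq_trans _ cJ) // leq_maxr.
  (* Deleting [u] as well makes [project] send the paths at [u] to their targets, which are
     scattered in [G]. *)
  pose S' := u |: S.
  have A2A1 x : x \in A2 -> x \in A1 by move/(subsetP A2J)/(subsetP JA1).
  have pS x : x \in A2 -> project S' x = f x.
    by move/A2A1/A1o => ox; rewrite /project /f ox setU11.
  exists (hubs n S'), A2; split=> //.
  - rewrite (leq_trans (leq_imset_card _ _)) // cardsU1.
    by case: (_ \notin _) => /=; lia.
  - by rewrite (subset_trans A2J) // (subset_trans JA1).
  - apply/pred0P => x /=; apply/negbTE/negP => /andP[/(subsetP A2J)/Jt[v tx _]].
    by case/imsetP=> w _ xw; rewrite xw in tx.
  move=> x y xA yA xy; apply: contra (sc x y xA yA xy) => nxy.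
  apply: (@near_sub _ (del (@adj G) S')); first by apply: del_sub; apply: subsetUr.
  rewrite -!pS //; apply: near_project => //; rewrite pS //.
  rewrite !inE negb_or nS // andbT.
  by have [v tx vu] := Jt _ (subsetP A2J _ yA); rewrite /f tx.
set B := [set i in Au | _] => cB.
have BAu : B \subset Au by apply/subsetP => x; rewrite inE => /andP[].
have Bo x : x \in B -> owner x = u by move/(subsetP BAu)/Auo.
have Bt x : x \in B -> target x = t by rewrite inE => /andP[_ /eqP].
have levinj : {in B &, forall x y, level x = level y -> x = y}.
  by move=> x y xB yB; apply: target_level_inj; rewrite ?Bo ?Bt.
have [v tv] : exists v, t = Some v.
  case: t @B cB Bt levinj {BAu Bo} => [v|] B cB Bt levinj; first by exists v.
  have : #|B| <= 1; last by rewrite /N3 in cB; lia.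
  apply/card_le1_eqP => x y xB yB; apply: levinj => //.
  by move: (Bt _ xB) (Bt _ yB); case: (x) => ? [[]|] //; case: (y) => ? [[]|].
(* Distinct levels that are congruent modulo [r.+1] differ by more than [r]. *)
have [|c] := @pigeonhole _ _ (fun x : subdiv n G => inord (level x %% r.+1) : 'I_r.+1) B m.
  by rewrite card_ord /N3 in cB *; lia.
set C := [set i in B | _] => cC.
have CB : C \subset B by apply/subsetP => x; rewrite inE => /andP[].
have Cm x : x \in C -> level x %% r.+1 = c.
  by rewrite inE => /andP[_ /eqP <-]; rewrite inordK // ltn_pmod.
exists [set ((u, None) : subdiv n G); (v, None)], C; split.
- by rewrite cards2; case: (_ != _).
- by rewrite (subset_trans CB) // (subset_trans BAu).
- exact: ltnW.
- apply/pred0P => x /=; apply/negbTE/negP => /andP[/(subsetP CB)/Bt].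
  by rewrite tv !inE => tx /orP[]/eqP xu; rewrite xu in tx.
move=> x y xC yC; apply: contraNN => nxy.
have [xB yB] := (subsetP CB _ xC, subsetP CB _ yC).
have [tx ty] := (Bt _ xB, Bt _ yB); rewrite tv in tx ty.
have [ox oy] := (Bo _ xB, Bo _ yB).
pose hu : subdiv n G := (u, None); pose hv : subdiv n G := (v, None).
have [uS vS] := (set21 hu hv, set22 hu hv).
have l1 : level y <= level x + r by apply: near_path uS vS oy ty ox tx nxy.
have l2 : level x <= level y + r.
  rewrite near_sym in nxy; last by apply/del_sym/adj_sym.
  exact: near_path uS vS ox tx oy ty nxy.
apply/eqP/levinj => //.
have := divn_eq (level x) r.+1; have := divn_eq (level y) r.+1.
rewrite (Cm _ xC) (Cm _ yC); move: (_ %/ _) (_ %/ _) => qy qx Ey Ex.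
have : qx = qy by case: (ltngtP qx qy) => // lt_q; nia.
by rewrite Ex Ey => ->.
Qed.

(** * Transductions *)

Lemma graph_iso_sym G H : graph_iso G H -> graph_iso H G.
Proof.
case=> f [g fK gK] fadj; exists g; first by exists f.
by move=> x y; rewrite -fadj !gK.
Qed.

Lemma graph_iso_trans G H K : graph_iso G H -> graph_iso H K -> graph_iso G K.
Proof.
case=> f bf fadj [g bg gadj]; exists (g \o f); first exact: bij_comp.
by move=> x y /=; rewrite gadj fadj.
Qed.

Lemma apply_interp_iso U U' (I : simple_interp U) (I' : simple_interp U')
    (G : colored_graph U) (G' : colored_graph U') (f : G -> G') :
  injective f -> (forall x, sat1 (nu I') (f x) = sat1 (nu I) x) ->
  (forall y, sat1 (nu I') y -> exists x, y = f x) ->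
  (forall x y, sat2 G' (eta I') (f x) (f y) = sat2 G (eta I) x y) ->
  graph_iso (apply_interp I G) (apply_interp I' G').
Proof.
move=> finj fnu fim feta.
have nuf (x : apply_interp I G) : sat1 (nu I') (f (val x)) by rewrite fnu (valP x).
pose F (x : apply_interp I G) : apply_interp I' G' := exist _ (f (val x)) (nuf x).
exists F; last by move=> x y; apply: feta.
apply: inj_card_bij => [x y [/finj/val_inj//]|].
have Finj : injective F by move=> x y [/finj/val_inj].
rewrite -(card_imset predT Finj); apply: subset_leq_card.
apply/subsetP => y _; have [x Ex] := fim _ (valP y).
have nux : sat1 (nu I) x by rewrite -fnu -Ex (valP y).
by apply/imsetP; exists (exist _ x nux) => //; apply: val_inj.
Qed.

Section Formulas.
Variable U : Type.

Definition FOr n (phi psi : formula U n) := FNot (FAnd (FNot phi) (FNot psi)).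

Lemma sat_FOr (G : colored_graph U) n (phi psi : formula U n) (e : n.-tuple G) :
  sat (FOr phi psi) e = sat phi e || sat psi e.
Proof. by rewrite /= negb_and !negbK. Qed.

Fixpoint FNear d n (i j : 'I_n) : formula U n :=
  if d is d'.+1 then
    FOr (FNear d' i j)
        (FEx (FAnd (FAdj U (lift ord0 i) ord0) (FNear d' ord0 (lift ord0 j))))
  else FEq U i j.

Lemma sat_FNear (G : colored_graph U) d n (i j : 'I_n) (e : n.-tuple G) :
  sat (FNear d i j) e = near (@adj G) d (tnth e i) (tnth e j).
Proof.
elim: d n i j e => [|d IH] n i j e //.
rewrite [FNear _ _ _]/= sat_FOr IH /=; congr (_ || _); apply: eq_existsb => z.
by rewrite IH !tnthS !tnth0.
Qed.

End Formulas.

Fixpoint relativize U U' (r : U -> U') (d : U') n (phi : formula U n) : formula U' n :=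
  match phi in formula _ n return formula U' n with
  | FEq _ i j => FEq U' i j
  | FAdj _ i j => FAdj U' i j
  | FColor _ u i => FColor (r u) i
  | FNot _ phi => FNot (relativize r d phi)
  | FAnd _ phi psi => FAnd (relativize r d phi) (relativize r d psi)
  | FEx _ phi => FEx (FAnd (FColor d ord0) (relativize r d phi))
  end.

Lemma sat_relativize U U' (r : U -> U') (d : U') (G : colored_graph U)
    (G' : colored_graph U') (f : G -> G') :
  injective f -> (forall x y, adj (f x) (f y) = adj x y) ->
  (forall u x, (f x \in color G' (r u)) = (x \in color G u)) ->
  (forall x, f x \in color G' d) ->
  (forall y, y \in color G' d -> exists x, y = f x) ->
  forall n (phi : formula U n) (e : n.-tuple G) (e' : n.-tuple G'),
  (forall i, tnth e' i = f (tnth e i)) -> sat (relativize r d phi) e' = sat phi e.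
Proof.
move=> finj fadj fcol fd dim n; elim=> {n}
  [n i j|n i j|n u i|n phi IH|n phi IH1 psi IH2|n phi IH] e e' He /=.
- by rewrite !He (inj_eq finj).
- by rewrite !He fadj.
- by rewrite He fcol.
- by rewrite (IH e).
- by rewrite (IH1 e) // (IH2 e).
have ext x : forall i, tnth [tuple of f x :: e'] i = f (tnth [tuple of x :: e] i).
  by move=> i; case: (unliftP ord0 i) => [j ->|->]; rewrite ?tnthS ?tnth0.
apply/existsP/existsP => [[y /andP[+ Hy]]|[x Hx]].
  rewrite tnth0 => /dim[x Ex]; exists x; rewrite -(IH _ _ (ext x)) //.
  by rewrite Ex in Hy.
by exists (f x); rewrite tnth0 fd (IH _ _ (ext x)).
Qed.

(** * Union of two transductions *)

Section Union.
Variables (U1 U2 : Type) (I1 : simple_interp U1) (I2 : simple_interp U2).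

(* [inl true] marks the domain, [inl false] selects the first interpretation. *)
Notation U := (bool + (U1 + U2))%type.
Let r1 (u : U1) : U := inr (inl u).
Let r2 (u : U2) : U := inr (inr u).
Let dom : U := inl true.
Let flag : U := inl false.

Definition union_nu : formula U 1 :=
  FAnd (FColor dom ord0)
    (FOr (FAnd (FColor flag ord0) (relativize r1 dom (nu I1)))
         (FAnd (FNot (FColor flag ord0)) (relativize r2 dom (nu I2)))).

(** Symmetry and irreflexivity must hold on every coloured graph, even where the colours are not
    placed as intended. Hence both ends have to lie in the domain and to agree on the flag. *)
Definition union_eta : formula U 2 :=
  FAnd (FAnd (FColor dom ord0) (FColor dom ord_max))
    (FOr (FAnd (FAnd (FColor flag ord0) (FColor flag ord_max))
               (relativize r1 dom (eta I1)))
         (FAnd (FAnd (FNot (FColor flag ord0)) (FNot (FColor flag ord_max)))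
               (relativize r2 dom (eta I2)))).

Lemma sat_union_nu (G : colored_graph U) x : sat1 (G := G) union_nu x =
  (x \in color G dom) && (if x \in color G flag then sat1 (relativize r1 dom (nu I1)) x
                          else sat1 (relativize r2 dom (nu I2)) x).
Proof.
rewrite /sat1 /= tnth0.
by case: (x \in color G flag); rewrite /= ?andbT ?negbK.
Qed.

Lemma sat_union_eta (G : colored_graph U) x y : sat2 G union_eta x y =
  [&& x \in color G dom, y \in color G dom &
   if (x \in color G flag) && (y \in color G flag)
   then sat2 G (relativize r1 dom (eta I1)) x y
   else [&& x \notin color G flag, y \notin color G flag &
         sat2 G (relativize r2 dom (eta I2)) x y]].
Proof.
rewrite /sat2 /union_eta.
have E1 : tnth [tuple x; y] ord_max = y by [].
rewrite /= E1 tnth0 -andbA.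
by case: (x \in color G flag); case: (y \in color G flag); rewrite /= ?andbT ?negbK.
Qed.

(** In this coloured graph the original formula means what the relativized one means in [G], so the
    symmetry and irreflexivity assumed of [I1] and [I2] carry over. *)
Definition restriction (G : colored_graph U) U' (r : U' -> U) : colored_graph U' :=
  @ColoredGraph U' (induced (color G dom)) (fun u => [set x | val x \in color G (r u)]).

Lemma sat_restriction (G : colored_graph U) U' (r : U' -> U) n (phi : formula U' n)
    (e : n.-tuple (restriction G r)) (e' : n.-tuple G) :
  (forall i, tnth e' i = val (tnth e i)) -> sat (relativize r dom phi) e' = sat phi e.
Proof.
apply: (@sat_relativize _ _ _ _ (restriction G r) G val) => //.
- exact: val_inj.
- by move=> u x; rewrite inE.
- by move=> x; apply: (valP x).
by move=> y yd; exists (exist _ y yd).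
Qed.

Lemma sat2_restriction (G : colored_graph U) U' (r : U' -> U) (phi : formula U' 2)
    x y (xd : x \in color G dom) (yd : y \in color G dom) :
  sat2 G (relativize r dom phi) x y =
  sat2 (restriction G r) phi (exist _ x xd) (exist _ y yd).
Proof.
apply: sat_restriction => i.
by case: (unliftP ord0 i) => [j ->|->]; rewrite ?tnthS ?tnth0 // ord1 tnth0.
Qed.

Lemma union_eta_sym (G : colored_graph U) : symmetric (sat2 G union_eta).
Proof.
move=> x y; rewrite !sat_union_eta andbCA.
case: (boolP (y \in color G dom)) => //= yd; case: (boolP (x \in color G dom)) => //= xd.
rewrite !(sat2_restriction _ _ xd yd) !(sat2_restriction _ _ yd xd).
rewrite (eta_sym I1) (eta_sym I2) [(x \in _) && _]andbC.
by rewrite [in RHS]andbCA.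
Qed.

Lemma union_eta_irr (G : colored_graph U) : irreflexive (sat2 G union_eta).
Proof.
move=> x; rewrite sat_union_eta; case: (boolP (x \in color G dom)) => //= xd.
by rewrite !(sat2_restriction _ _ xd xd) (eta_irr I1) (eta_irr I2) !andbF if_same.
Qed.

Definition union_interp := @SimpleInterp _ union_nu _ union_eta_sym union_eta_irr.

End Union.

Definition widen_copy k k' (kk : k <= k') G (x : copy k G) : copy k' G :=
  (widen_ord kk x.1, x.2).
Arguments widen_copy {k k'} kk {G} x.

Lemma widen_copy_inj k k' (kk : k <= k') G : injective (@widen_copy k k' kk G).
Proof. by move=> [i u] [j v] [/= Eij ->]; congr (_, _); apply: val_inj. Qed.

Lemma apply_interp_widen U U' (r : U -> U') (d : U') (I : simple_interp U)
    (I' : simple_interp U') k k' (kk : k <= k') G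
    (c : U -> {set copy k G}) (c' : U' -> {set copy k' G}) :
  (forall u, c' (r u) = widen_copy kk @: c u) ->
  c' d = [set x : 'I_k' * G | x.1 < k] ->
  (forall x, sat1 (G := ColoredGraph c') (nu I') x =
     (x \in c' d) && sat1 (G := ColoredGraph c') (relativize r d (nu I)) x) ->
  (forall x y, sat2 (ColoredGraph c') (eta I') x y =
     [&& x \in c' d, y \in c' d & sat2 (ColoredGraph c') (relativize r d (eta I)) x y]) ->
  graph_iso (apply_interp I (ColoredGraph c)) (apply_interp I' (ColoredGraph c')).
Proof.
move=> cr cd nuE etaE; pose w := @widen_copy k k' kk G.
have winj : injective w := @widen_copy_inj _ _ _ _.
have wd x : w x \in c' d by rewrite cd inE /= ltn_ord.
have wim x : x \in c' d -> exists x', x = w x'.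
  case: x => i u; rewrite cd inE /= => ik; exists (Ordinal ik, u).
  by congr (_, _); apply: val_inj.
have sat_w n (phi : formula _ n) := @sat_relativize _ _ r d
  (ColoredGraph c) (ColoredGraph c') w winj (fun _ _ => erefl)
  (fun u x => etrans (congr1 (fun A : {set _} => w x \in A) (cr u)) (mem_imset (c u) x winj))
  wd wim n phi.
apply: (@apply_interp_iso _ _ I I' (ColoredGraph c) (ColoredGraph c') w winj).
- by move=> x; rewrite nuE wd; apply: sat_w => i; rewrite ord1 !tnth0.
- by move=> y; rewrite nuE => /andP[/wim].
move=> x y; rewrite etaE !wd; apply: sat_w => i.
by case: (unliftP ord0 i) => [j ->|->]; rewrite ?tnthS ?tnth0 // ord1 tnth0.
Qed.

(** The larger number of copies is taken; the domain colour marks the first copies, as many as the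
    simulated transduction uses, and the flag tells which of the two is simulated. *)
Lemma transduction_union (T1 T2 : transduction) : exists T : transduction,
  forall G H, transduces T1 G H \/ transduces T2 G H -> transduces T G H.
Proof.
pose k := maxn (copies T1) (copies T2).
have k0 : 0 < k by rewrite leq_max (copies_gt0 T1).
exists (Transduction k0 (union_interp (interp T1) (interp T2))) => G H.
case=> -[c iso].
  have kT : copies T1 <= k := leq_maxl _ _.
  exists (fun u : bool + (colors T1 + colors T2) => match u with
    | inl true => [set x : 'I_k * G | x.1 < copies T1]
    | inl false => setT
    | inr (inl u) => widen_copy kT @: c u
    | inr (inr u) => set0
    end).
  apply: graph_iso_trans iso (apply_interp_widen (r := fun u => inr (inl u))
    (d := inl true) (kk := kT) _ _ _ _) => //.
    by move=> x; rewrite sat_union_nu /= in_setT.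
  by move=> x y; rewrite sat_union_eta /= !in_setT.
have kT : copies T2 <= k := leq_maxr _ _.
exists (fun u : bool + (colors T1 + colors T2) => match u with
  | inl true => [set x : 'I_k * G | x.1 < copies T2]
  | inl false => set0
  | inr (inl u) => set0
  | inr (inr u) => widen_copy kT @: c u
  end).
apply: graph_iso_trans iso (apply_interp_widen (r := fun u => inr (inr u))
  (d := inl true) (kk := kT) _ _ _ _) => //.
  by move=> x; rewrite sat_union_nu /= in_set0.
by move=> x y; rewrite sat_union_eta /= !in_set0.
Qed.

(** * Recovering a graph from its subdivision *)

Section Decode.
Variables (n : nat) (G : sgraph).
Hypothesis n_gt0 : 0 < n.
Notation hub u := ((u, None) : subdiv n G).

Lemma near_hub_leg (u v : G) l (ln : l < n) :
  near (@adj (subdiv n G)) l.+1 (hub u) (u, Some (v, Ordinal ln)).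
Proof.
elim: l ln => [|l IH] ln.
  by apply: near_step (near_refl _ 0 _); rewrite /= /subdiv_adj /= !eqxx.
rewrite -addn1; apply: near_trans (IH (ltnW ln)) (near_step _ (near_refl _ 0 _)).
by rewrite /= /subdiv_adj /= !eqxx.
Qed.

(** A shortest path climbs [n] edges, crosses one and descends [n]. The invariant separates the star
    of [u], the paths towards [u] at its neighbours, and the hubs of the neighbours, reached only
    when the whole length is spent. *)
Lemma near_hubs (u v : G) : u != v ->
  near (@adj (subdiv n G)) n.*2.+1 (hub u) (hub v) = adj u v.
Proof.
move=> uv; apply/idP/idP => [|a].
  rewrite near_sym; last exact: adj_sym.
  pose ht (y : subdiv n G) := if target y is Some _ then (level y).+1 else 0.
  move=> /(@near_inv _ _ (fun d y => d <= n.*2.+1 ->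
    [\/ owner y = u /\ ht y <= d,
        [/\ adj u (owner y), target y = Some u & n.*2 <= d + level y] |
        [/\ adj u (owner y), target y = None & d = n.*2.+1]])) H.
  have [|||[E _]|[_ E _]|[E _ _]] := H _ _ _ (leqnn _) => //.
  - by move=> _; apply: Or31.
  - move=> d y IH ld; have [[H1 H2]|[H1 H2 H3]|[_ _ H3]] := IH (ltnW ld).
    + by apply: Or31; split=> //; apply: leqW.
    + by apply: Or32; split=> //; lia.
    by lia.
  - move=> d y z yz IH ld; have {IH}[[H1 H2]|[H1 H2 H3]|[_ _ H3]] := IH (ltnW ld).
    + have [[E1 E2 E3]|[E1 [_ [E2 E3]]]|[E1 E2 E3 E4 E5]] := subdiv_adjP yz.
      * apply: Or31; split; first by rewrite E1.
        by move: H2; rewrite /ht E2; case: (target z) => [_|] //; lia.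
      * apply: Or31; split; first by rewrite E1.
        by rewrite /ht; case: (target y) => [_|] //; lia.
      apply: Or32; split; first by rewrite adj_sym -H1.
        by rewrite E2 H1.
      by move: H2; rewrite /ht E1; lia.
    + have [[E1 E2 E3]|[E1 [[E|E] [E2 E3]]]|[E1 E2 E3 E4 E5]] := subdiv_adjP yz.
      * by apply: Or32; rewrite E1 E2; split=> //; lia.
      * by apply: Or33; rewrite E1; split=> //; lia.
      * by rewrite E in H2.
      apply: Or31; split; first by move: H2; rewrite E1 => -[].
      by rewrite /ht E2; lia.
    by lia.
  by case/eqP: uv; rewrite -E.
have ln : n.-1 < n by rewrite prednK.
have -> : n.*2.+1 = n + (1 + n) by lia.
have nn : n.-1.+1 = n by apply: prednK.
have H w w' : near (@adj (subdiv n G)) n (hub w) (w, Some (w', Ordinal ln)).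
  by have := near_hub_leg w w' ln; rewrite nn.
apply: near_trans (H u v) _.
rewrite add1n; apply: near_step (_ : near _ _ (v, Some (u, Ordinal ln)) _).
  by rewrite /= /subdiv_adj /= !eqxx nn eqxx a orbT.
by rewrite (near_sym (@adj_sym (subdiv n G))); apply: H.
Qed.

End Decode.

Lemma near_bij (V W : finType) (R : rel V) (R' : rel W) (f : V -> W) d x y :
  bijective f -> (forall x y, R' (f x) (f y) = R x y) ->
  near R' d (f x) (f y) = near R d x y.
Proof.
case=> g fK gK fR; elim: d x => [|d IH] x /=; first by rewrite (can_eq fK).
rewrite IH; congr (_ || _); apply/existsP/existsP => -[z].
  by rewrite -[z]gK fR IH => H; exists (g z).
by rewrite -fR -IH => H; exists (f z).
Qed.

Definition decode_eta n : formula unit 2 :=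
  FAnd (FNot (FEq unit ord0 ord_max)) (FNear unit n.*2.+1 ord0 ord_max).

Lemma sat_decode_eta n (G : colored_graph unit) x y :
  sat2 G (decode_eta n) x y = (x != y) && near (@adj G) n.*2.+1 x y.
Proof.
transitivity ((tnth [tuple x; y] ord0 != tnth [tuple x; y] ord_max) &&
  sat (FNear unit n.*2.+1 ord0 ord_max) [tuple x; y]); first by [].
by rewrite sat_FNear (_ : tnth _ ord_max = y) // tnth0.
Qed.

Lemma decode_eta_sym n (G : colored_graph unit) : symmetric (sat2 G (decode_eta n)).
Proof.
by move=> x y; rewrite !sat_decode_eta eq_sym near_sym //; apply: adj_sym.
Qed.

Lemma decode_eta_irr n (G : colored_graph unit) : irreflexive (sat2 G (decode_eta n)).
Proof. by move=> x; rewrite sat_decode_eta eqxx. Qed.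

Definition decode n : transduction :=
  @Transduction 1 isT unit
    (@SimpleInterp _ (FColor tt ord0) _ (@decode_eta_sym n) (@decode_eta_irr n)).

Lemma decode_subdiv n G : 0 < n -> transduces (decode n) (subdiv n G) G.
Proof.
move=> n0.
pose c (_ : unit) : {set copy 1 (subdiv n G)} := [set x | x.2.2 == None].
exists c.
pose f (u : G) : copy 1 (subdiv n G) := (ord0, (u, None)).
have nuE x : sat1 (G := @ColoredGraph _ (copy 1 (subdiv n G)) c)
    (nu (interp (decode n))) x = (x \in c tt).
  by rewrite /sat1 /= tnth0.
have nuf u : sat1 (G := @ColoredGraph _ (copy 1 (subdiv n G)) c)
    (nu (interp (decode n))) (f u) by rewrite nuE inE.
exists (fun u => exist _ (f u) (nuf u)).
  exists (fun x => (val x).2.1) => // -[[i [u o]] Hx]; apply: val_inj => /=.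
  by have := Hx; rewrite nuE inE /= => /eqP->; rewrite /f ord1.
move=> u v; rewrite /= /interp_adj /= sat_decode_eta.
case: (eqVneq u v) => [->|uv]; first by rewrite eqxx adj_irr.
rewrite (_ : f u != f v); last by apply: contra uv => /eqP[->].
rewrite andTb -(near_hubs (n := n) n0 uv).
apply: (@near_bij _ _ (@adj (subdiv n G)) (@adj (copy 1 (subdiv n G))) (pair ord0) _
  (u, None) (v, None)).
  by exists snd => // -[i x] /=; rewrite ord1.
by move=> x y; rewrite /= /copy_adj eqxx.
Qed.

(** * The two classes *)

(** The creation sequence of a threshold graph: along [f], each vertex is added as dominating if [b]
    holds and as isolated otherwise. *)
Definition threshold (G : sgraph) := exists (f : G -> nat) (b : G -> bool),
  injective f /\
  forall x y, adj x y = (x != y) && (if f x < f y then b y else b x).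

Lemma no_bicliqueP s n G : s <= n -> ~ is_subgraph (Kbip s s) G -> no_biclique n G.
Proof.
move=> sn nK Y Z cY cZ.
case: (boolP [exists y in Y, [exists z in Z, ~~ adj y z]]).
  by move=> /existsP[y /andP[yY /existsP[z /andP[zZ nyz]]]]; exists y, z.
rewrite negb_exists => /forallP H; case: nK.
have full y z : y \in Y -> z \in Z -> adj y z.
  move=> yY zZ; have := H y; rewrite yY /= negb_exists => /forallP/(_ z).
  by rewrite zZ /= negbK.
pose fY (i : 'I_s) := enum_val (widen_ord (leq_trans sn cY) i).
pose fZ (i : 'I_s) := enum_val (widen_ord (leq_trans sn cZ) i).
have adjYZ i j : adj (fY i) (fZ j) by apply: full; apply: enum_valP.
have fYZ i j : fY i <> fZ j by move=> E; have := adjYZ i j; rewrite E adj_irr.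
exists (fun x => match x with inl i => fY i | inr j => fZ j end).
  move=> [i|i] [j|j] E; try by [case: (fYZ _ _ E)|case: (fYZ _ _ (esym E))].
    by congr inl; have /(congr1 val) /= := enum_val_inj E; apply: val_inj.
  by congr inr; have /(congr1 val) /= := enum_val_inj E; apply: val_inj.
by move=> [i|i] [j|j] //= _; rewrite 1?adj_sym.
Qed.

(** A coloured threshold graph is a word whose letters record [b] and the relevant colours in every
    copy. Equal order types then satisfy the formulas of [T] alike by [sat_back_forth], and [n]
    exceeds all parameters involved. *)
Theorem word_graph_of_threshold (T : transduction) s : exists2 n, 0 < n &
  forall G H, threshold G -> transduces T G H -> ~ is_subgraph (Kbip s s) H ->
  word_graph n H.
Proof.
pose k := copies T; pose nu0 := nu (interp T); pose eta0 := eta (interp T).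
pose cs := colors_of nu0 ++ colors_of eta0.
(* [None] is the letter of positions without a vertex; vertices sit at [(f v).+1], which leaves 0
   free as a sentinel. *)
pose K : finType := option (bool * {ffun 'I_k * 'I_(size cs) -> bool}).
pose n := (k + #|K| + rank nu0 + rank eta0 + s).+1.
have kn : k <= n by rewrite /n; lia.
have Kn : #|K| <= n by rewrite /n; lia.
exists n => // G H [f [b [finj adjE]]] [c [psi psibij psiadj]] nK.
have [phi psiK phiK] := psibij.
pose code v : K := Some (b v, [ffun ij => (ij.1, v) \in c (tnth (in_tuple cs) ij.2)]).
pose lab (o : K) : 'I_n := widen_ord Kn (enum_rank o).
have lab_inj : injective lab.
  by move=> o o' /(congr1 val) /= /val_inj/enum_rank_inj.
pose col t := lab (if [pick v | (f v).+1 == t] is Some v then code v else None).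
have colf v : col (f v).+1 = lab (code v).
  rewrite /col; case: pickP => [w /eqP[/finj->] //|/(_ v)].
  by rewrite eqxx.
have col_vertex v t : col (f v).+1 = col t -> exists2 v', t = (f v').+1 & code v = code v'.
  rewrite colf /col => /lab_inj; case: pickP => [v' /eqP <- E|//].
  by exists v'.
pose B := (\max_v f v).+2.
have fB v : 0 < (f v).+1 < B by rewrite /B /= !ltnS leq_bigmax.
pose pr (a : G * G) := ((f a.1).+1, (f a.2).+1).
pose Z q (p : seq (G * G)) := order_bf col q (map pr p ++ [:: (0, 0); (B, B)]).
have Zends (p : seq (G * G)) : (0, 0) \in map pr p ++ [:: (0, 0); (B, B)] /\
    (B, B) \in map pr p ++ [:: (0, 0); (B, B)].
  by split; rewrite mem_cat !inE eqxx ?orbT.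
have Zf q p v : Z q.+1 p -> exists v', Z q ((v, v') :: p).
  move=> Zp; have [p0 pB] := Zends p.
  have [t _ Ht] := order_bf_forth Zp p0 pB (fB v).
  have [/= Ec _ _] := Ht _ _ (mem_head _ _) (mem_head _ _).
  have [v' Ev' _] := col_vertex _ _ Ec.
  by exists v'; rewrite /Z /= /pr /= -Ev'.
have Zb q p v' : Z q.+1 p -> exists v, Z q ((v, v') :: p).
  move=> Zp; have [p0 pB] := Zends p.
  have [t _ Ht] := order_bf_back Zp p0 pB (fB v').
  have [/= Ec _ _] := Ht _ _ (mem_head _ _) (mem_head _ _).
  have [v Ev _] := col_vertex _ _ (esym Ec).
  by exists v; rewrite /Z /= /pr /= -Ev.
have Za q p a a' : Z q p -> a \in p -> a' \in p ->
    [/\ (a.1 == a'.1) = (a.2 == a'.2), adj a.1 a'.1 = adj a.2 a'.2 &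
        forall i (j : 'I_(size cs)), ((i, a.1) \in c (tnth (in_tuple cs) j)) =
                                     ((i, a.2) \in c (tnth (in_tuple cs) j))].
  move=> Zp ap ap'.
  have prp x : x \in p -> pr x \in map pr p ++ [:: (0, 0); (B, B)].
    by move=> xp; rewrite mem_cat map_f.
  have [/= C1 L1 _] := Zp _ _ (prp _ ap) (prp _ ap').
  have [/= C2 L2 _] := Zp _ _ (prp _ ap') (prp _ ap).
  rewrite !ltnS in L1 L2.
  have [Eb Ecol] : b a.1 = b a.2 /\ forall i (j : 'I_(size cs)),
      ((i, a.1) \in c (tnth (in_tuple cs) j)) = ((i, a.2) \in c (tnth (in_tuple cs) j)).
    move: C1; rewrite !colf => /lab_inj[-> /ffunP E]; split=> // i j.
    by have := E (i, j); rewrite !ffunE.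
  have Eb' : b a'.1 = b a'.2 by move: C2; rewrite !colf => /lab_inj[].
  have E12 : (a.1 == a'.1) = (a.2 == a'.2).
    apply/eqP/eqP => E; apply/finj/eqP; rewrite eqn_leq leqNgt [X in _ && X]leqNgt.
      by rewrite -L2 -L1 E !ltnn.
    by rewrite L1 L2 E !ltnn.
  split=> //; rewrite !adjE E12 Eb Eb'.
  by rewrite L1.
have satZ m (phi0 : formula (colors T) m) p (e e' : m.-tuple (copy k G)) :
    covers cs phi0 -> rank phi0 <= n -> Z n p ->
    (forall i, (tnth e i).1 = (tnth e' i).1 /\ ((tnth e i).2, (tnth e' i).2) \in p) ->
    sat (G := @ColoredGraph _ (copy k G) c) phi0 e =
    sat (G := @ColoredGraph _ (copy k G) c) phi0 e'.
  exact: sat_back_forth.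
pose pos z : copy k G := val (psi z).
have posinj : injective pos by move=> z w /val_inj/(bij_inj psibij).
pose h z : 'I_n * nat := (widen_ord kn (pos z).1, (f (pos z).2).+1).
exists B, col, h; split.
- move=> z w [/eqP E1 /finj E2]; apply: posinj.
  rewrite [pos z]surjective_pairing [pos w]surjective_pairing E2; congr (_, _).
  by apply: val_inj; apply/eqP.
- by move=> z; apply: fB.
- move=> z t _ Ht.
  have [/= Ec _ _] := Ht _ _ (mem_head _ _) (mem_head _ _).
  have [v' Et _] := col_vertex _ _ Ec.
  have nuv : sat1 (G := @ColoredGraph _ (copy k G) c) nu0 ((pos z).1, v').
    rewrite /sat1 -(satZ _ nu0 [:: ((pos z).2, v')] [tuple pos z]).
    + exact: (valP (psi z)).
    + by exists [::], (colors_of eta0).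
    + by rewrite /n; lia.
    + by rewrite /Z /= /pr /= -Et.
    by move=> i; rewrite ord1 !tnth0 /= mem_head.
  exists (phi (exist (sat1 (G := @ColoredGraph _ (copy k G) c) nu0) _ nuv)).
  by rewrite /h /pos phiK /= Et.
- move=> y z y' z' /(congr1 val) /= cy /(congr1 val) /= cz Hyz.
  have {}cy : (pos y).1 = (pos y').1 by apply: val_inj.
  have {}cz : (pos z).1 = (pos z').1 by apply: val_inj.
  rewrite -!psiadj; apply: (satZ _ eta0 [:: ((pos y).2, (pos y').2); ((pos z).2, (pos z').2)]).
  + by exists (colors_of nu0), [::]; rewrite cats0.
  + by rewrite /n; lia.
  + exact: Hyz.
  move=> i; case: (unliftP ord0 i) => [j ->|->]; rewrite ?tnthS ?tnth0.
    by rewrite ord1 !tnth0 !inE eqxx orbT.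
  by rewrite mem_head.
by apply: no_bicliqueP nK; rewrite /n; lia.
Qed.

(** * Construction of the two hereditary classes *)

Section Edgeless.
Variable N : nat.
Definition edgeless_adj : rel 'I_N := fun _ _ => false.
Lemma edgeless_sym : symmetric edgeless_adj. Proof. by []. Qed.
Lemma edgeless_irr : irreflexive edgeless_adj. Proof. by []. Qed.
Definition edgeless := SGraph edgeless_sym edgeless_irr.

Lemma word_graph_edgeless : word_graph 1 edgeless.
Proof.
exists N.+1, (fun=> ord0), (fun i : 'I_N => (ord0, i.+1)); split=> //.
- by move=> i j [/val_inj].
- by move=> i /=; rewrite ltnS.
- move=> i [|t] // /andP[_ tN] _.
  by exists (Ordinal (tN : t < N)).
by move=> Y Z /card_gt0P[y yY] /card_gt0P[z zZ]; exists y, z.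
Qed.
End Edgeless.

Definition subdivided_word_graph (G : sgraph) := exists n G',
  word_graph n G' /\ exists2 f : G -> subdiv n G',
    injective f & forall x y, adj (f x) (f y) = adj x y.

(** Quasi-wideness passes to induced subgraphs by taking the preimage of the deleted set. *)
Lemma subdivided_word_graph_uqw : uniformly_quasi_wide subdivided_word_graph.
Proof.
move=> r; have [g Hg] := subdiv_quasi_wide r; exists g => m.
have [N HN] := Hg m; exists N => G [n [G' [wg [f finj fadj]]]] A cA.
have [S [J [cS JA cJ nS sc]]] := quasi_wide_family (HN n G' wg) (in2W finj) cA.
exists (f @^-1: S), J; split=> //.
- apply: leq_trans cS; apply: (card_in_leq (in2W finj)).
  by move=> x; rewrite inE.
- by apply/pred0P => x /=; rewrite inE; apply/negbTE/negP => /andP[/nS/negbTE->].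
move=> x y xJ yJ xy; apply: contra (sc x y xJ yJ xy).
elim: r {Hg HN sc} x {xJ xy} => [|r IH] x /=; first by rewrite (inj_eq finj).
case/orP=> [/IH-> //|/existsP[z /andP[/and3P[xz xS zS] /IH zy]]].
apply/orP; right; apply/existsP; exists (f z).
rewrite !inE in xS zS; rewrite zy andbT; apply/and3P; split=> //.
by rewrite -fadj in xz.
Qed.

Lemma threshold_infinite n (L : 'I_n -> sgraph) (P : sgraph -> Prop) :
  (forall N, exists2 G : sgraph, P G & N <= #|G|) ->
  exists2 G, P G & forall i, ~ graph_iso G (L i).
Proof.
move=> /(_ (\max_i #|L i|).+1)[G PG cG]; exists G => // i [f fbij _].
have : #|L i| <= \max_j #|L j| by apply: (@leq_bigmax _ (fun j => #|L j|)).
by rewrite -(bij_eq_card fbij) leqNgt cG.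
Qed.

Lemma subdivided_iso G H : graph_iso G H -> subdivided_word_graph G ->
  subdivided_word_graph H.
Proof.
move=> /graph_iso_sym[g gbij gadj] [n [G' [wg [f finj fadj]]]].
exists n, G'; split=> //; exists (f \o g); first exact: inj_comp (bij_inj gbij).
by move=> x y; apply: etrans (fadj _ _) (gadj _ _).
Qed.

Lemma subdivided_induced (G : sgraph) (S : {set G}) : subdivided_word_graph G ->
  subdivided_word_graph (induced S).
Proof.
case=> n [G' [wg [f finj fadj]]]; exists n, G'; split=> //.
exists (f \o val); first exact: inj_comp finj val_inj.
by move=> x y; apply: etrans (fadj _ _) _.
Qed.

Lemma subdivided_empty : subdivided_word_graph empty_graph.
Proof.
exists 1, (edgeless 0); split; first exact: word_graph_edgeless.
by exists (fun x : void => match x with end); case.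
Qed.

Lemma subdivided_large N : exists2 G, subdivided_word_graph G & N <= #|G|.
Proof.
exists (subdiv 1 (edgeless N)).
  by exists 1, (edgeless N); split; [apply: word_graph_edgeless|exists id].
rewrite card_prod card_option /= card_ord leq_pmulr //.
Qed.

Lemma threshold_iso G H : graph_iso G H -> threshold G -> threshold H.
Proof.
move=> /graph_iso_sym[g gbij gadj] [f [b [finj adjE]]].
exists (f \o g), (b \o g); split; first exact: inj_comp (bij_inj gbij).
by move=> x y /=; rewrite -gadj adjE (bij_eq gbij).
Qed.

Lemma threshold_induced (G : sgraph) (S : {set G}) : threshold G -> threshold (induced S).
Proof.
case=> f [b [finj adjE]]; exists (f \o val), (b \o val).
split; first exact: inj_comp finj val_inj.
by move=> x y; rewrite /= /induced_adj adjE.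
Qed.

Definition subdivided_class : graph_class :=
  GraphClass subdivided_iso subdivided_empty subdivided_induced
    (fun n L => @threshold_infinite n L _ subdivided_large).

Definition joint G := subdivided_word_graph G \/ threshold G.

Lemma joint_iso G H : graph_iso G H -> joint G -> joint H.
Proof.
by move=> iso [H1|H1]; [left; apply: subdivided_iso H1|right; apply: threshold_iso H1].
Qed.

Lemma joint_induced (G : sgraph) (S : {set G}) : joint G -> joint (induced S).
Proof. by case=> [/subdivided_induced|/threshold_induced]; [left|right]. Qed.

Lemma joint_large N : exists2 G, joint G & N <= #|G|.
Proof. by have [G HG cG] := subdivided_large N; exists G => //; left. Qed.

Definition joint_class : graph_class :=
  GraphClass joint_iso (or_introl subdivided_empty) joint_induced
    (fun n L => @threshold_infinite n L _ joint_large).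

(** * Half-graphs inside threshold graphs *)

Section HalfGraph.
Variable N : nat.
Definition ladder_adj : rel ('I_N * bool) := fun x y =>
  (x != y) && (if x.1.*2 + x.2 < y.1.*2 + y.2 then y.2 else x.2).

Lemma ladder_rank_inj : injective (fun x : 'I_N * bool => x.1.*2 + x.2).
Proof.
by move=> [i a] [j b] /= E; congr (_, _); [apply: val_inj => /=|];
  case: a E; case: b => /= E; lia.
Qed.

Lemma ladder_sym : symmetric ladder_adj.
Proof.
move=> x y; rewrite /ladder_adj eq_sym; case: (eqVneq y x) => //= yx.
case: ltngtP => // E; first by rewrite (ladder_rank_inj E) eqxx in yx.
Qed.

Lemma ladder_irr : irreflexive ladder_adj.
Proof. by move=> x; rewrite /ladder_adj eqxx. Qed.

Definition ladder := SGraph ladder_sym ladder_irr.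

Lemma ladder_threshold : threshold ladder.
Proof.
by exists (fun x : 'I_N * bool => x.1.*2 + x.2), snd; split; first exact: ladder_rank_inj.
Qed.

Lemma ladder_half i j : @adj ladder (i, false) (j, true) = (i <= j).
Proof. by rewrite /= /ladder_adj /= xpair_eqE andbF /= addn0 addn1 ltnS leq_double; case: leqP. Qed.
End HalfGraph.

Lemma joint_not_le_subdivided : ~ fo_le joint_class subdivided_class.
Proof.
case=> T HT.
have [N HN] := quasi_wide_no_half_graph (copies T) (eta (interp T)) subdivided_word_graph_uqw.
have [G GD [c [f fbij fadj]]] := HT (ladder N) (or_intror (ladder_threshold N)).
apply: (HN G c (fun i => val (f (i, false))) (fun j => val (f (j, true))) GD) => i j.
by rewrite -ladder_half -fadj.
Qed.

(** The graphs of [F] obtained from threshold graphs are all word graphs of one parameter [n]; each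
    is returned by [decode n] from its own subdivision, which lies in the subdivided class. *)
Lemma weakly_sparse_le F : weakly_sparse F ->
  fo_le F joint_class <-> fo_le F subdivided_class.
Proof.
move=> [s Fs]; split=> -[T HT]; last first.
  by exists T => H /HT[G GD tG]; exists G => //; left.
have [n n0 Hn] := word_graph_of_threshold T s.
have [T' HT'] := transduction_union T (decode n).
exists T' => H FH; have [G [GD|GT] tG] := HT _ FH.
  by exists G => //; apply: HT'; left.
exists (subdiv n H); last by apply: HT'; right; apply: decode_subdiv.
exists n, H; split; last by exists id.
exact: Hn GT tG (Fs _ FH).
Qed.

Theorem proposition21p5 : ~ sup_dense weakly_sparse.
Proof.
move=> /(_ joint_class subdivided_class)[_ dense].
have [le_joint _] := dense weakly_sparse_le.
exact: joint_not_le_subdivided le_joint.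
Qed.
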